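(* Let $I=[0,1]$ and let $\mathcal{F}=\{a_j\}_{j=1}^{\infty}$ be the sequence of fast Leja points on $I$ (with midpoint candidate points). Suppose Property $(\star)$ holds for the sequence $\mathcal{F}$. Then $$\lim_{n\to\infty} |VDM(a_1,\ldots,a_n)|^{\frac{2}{n(n+1)}} = d(I),$$ where $d(I)$ is the transfinite diameter of $I$. Hence $\mathcal{F}$ is good for polynomial interpolation on $I$.
   Context: **Fast Leja points on $[0,1]$ (midpoint candidates).** They are constructed inductively. Put $t_0=0$, $t_1=1$, $s_1=\tfrac12$, $T_1=\{t_0,t_1\}$, $S_1=\{s_1\}$. For $n\ge 2$, given $T_{n-1}=\{t_0,\ldots,t_{n-1}\}$ (the fast Leja points so far) and $S_{n-1}=\{s_1,\ldots,s_{n-1}\}$ (the candidate points), let $p_n(z)=(z-t_0)\cdots(z-t_{n-1})$ and choose $s_k\in S_{n-1}$ with $|p_n(s_k)|=\max\{|p_n(s_j)| : j=1,\ldots,n-1\}$ (any choice in case of ties). Put $t_n:=s_k$, $T_n:=T_{n-1}\cup\{t_n\}$, and let $S_n$ be obtained from $S_{n-1}$ by removing $s_k$ and adding the midpoints $a,b$ of the two intervals joining $s_k$ to the adjacent points of $T_{n-1}$ on its left and right. Thus $S_n$ is always the set of midpoints of the intervals between adjacent points of $T_n$. The sequence of fast Leja points is $t_0,t_1,t_2,\ldots$, indexed in the claim as $a_j=t_{j-1}$, $j\ge1$. **Property $(\star)$.** Consider a triangular array of real points whose stage $n$ consists of distinct points listed in increasing order $\zeta_{n1}<\zeta_{n2}<\cdots<\zeta_{nn}$.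 For $j\in\{1,\ldots,n-1\}$ put $$m_{nj}:=\tfrac12(\zeta_{nj}+\zeta_{n(j+1)}),\quad s_n(j):=|m_{nj}-\zeta_{nj}|,\quad H_n(j):=\left(\frac1n\sum_{k=1}^n\frac{1}{|m_{nj}-\zeta_{nk}|}\right)^{-1}.$$ The array has Property $(\star)$ if $$\lim_{n\to\infty}\max\left\{\frac{s_n(j)}{H_n(j)} : j=1,\ldots,n-1\right\}=0.$$ A sequence has Property $(\star)$ if the array whose $n$-th stage is the first $n$ points of the sequence, listed in increasing order, has Property $(\star)$. **Vandermonde determinant and transfinite diameter.** $VDM(a_1,\ldots,a_n)=\det[a_j^{\,i-1}]_{i,j=1}^n$. For compact $K\subset\mathbb{C}$, $$d_n(K):=\sup\{|VDM(a_1,\ldots,a_n)|^{\frac{2}{n(n+1)}} : \{a_1,\ldots,a_n\}\subset K\},\qquad d(K):=\lim_{n\to\infty}d_n(K).$$ **Good for polynomial interpolation.** A sequence $\{a_j\}_{j=1}^\infty$ of distinct points of a compact set $K\subset\mathbb{C}$ is good for polynomial interpolation on $K$ if for every function $f$ analytic in a neighborhood of $K$ in $\mathbb{C}$, $L_nf\to f$ uniformly on $K$ as $n\to\infty$, where $L_nf$ is the unique polynomial of degree at most $n$ with $L_nf(a_j)=f(a_j)$ for $j=1,\ldots,n+1$. *)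

(* Defs.v *)
(* The complex plane is R[i], for R : realType; its topology is the one
   carried by the regular algebra R[i]^o, hence the casts below. *)
From HB Require Import structures.
From mathcomp Require Import all_boot all_order all_algebra.
From mathcomp Require Import all_classical all_reals all_analysis.
From mathcomp Require Import qpoly.
From mathcomp Require Import complex.

Set Implicit Arguments.
Unset Strict Implicit.
Unset Printing Implicit Defensive.

Import Order.TTheory GRing.Theory Num.Theory.
Import numFieldNormedType.Exports.
Import ComplexField.Normc.

Local Open Scope classical_set_scope.
Local Open Scope ring_scope.
Local Open Scope complex_scope.

(* Sequences are indexed from 0: t j is the point written t_j, that is a_(j+1),
   and "the first n points" are t 0, ..., t n.-1. *)

Section FastLeja.
Variable R : realType.
Implicit Types (t : nat -> R) (S : nat -> set R).

Definition first_points t n : set R := [set t i | i in `I_n].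

Definition node_prod t n (z : R) : R := \prod_(i < n) (z - t i).

Definition adjacent_points (T : set R) (s l r : R) : Prop :=
  [/\ T l, T r, l < s < r & forall y, T y -> y <= l \/ r <= y].

(* S n is the set of candidates attached to t 0, ..., t n.  The relation allows
   any choice of t n among the maximizers. *)
Definition fast_leja_step t S n : Prop :=
  [/\ S n.-1 (t n),
      forall s, S n.-1 s -> `|node_prod t n s| <= `|node_prod t n (t n)|
    & exists l r, adjacent_points (first_points t n) (t n) l r /\
        S n = (S n.-1 `\ t n) `|` [set (l + t n) / 2; (t n + r) / 2] ].

Definition fast_leja_sequence t : Prop :=
  exists S, [/\ t 0%N = 0, t 1%N = 1, S 1%N = [set 2^-1]
    & forall n, (2 <= n)%N -> fast_leja_step t S n].

End FastLeja.

Section PropertyStar.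
Variable R : realType.

Section Stage.
Variables (n : nat) (zeta : n.-tuple R).

Definition mid (j : nat) : R := (zeta`_j + zeta`_j.+1) / 2.

Definition half_gap (j : nat) : R := `|mid j - zeta`_j|.

Definition harmonic_dist (j : nat) : R :=
  (n%:R^-1 * \sum_(k < n) `|mid j - zeta`_k|^-1)^-1.

(* The ratios are nonnegative, so 0 is a neutral default for the maximum. *)
Definition max_ratio : R :=
  \big[Num.max/0]_(j < n.-1) (half_gap j / harmonic_dist j).

End Stage.

Definition property_star (zeta : forall n, n.-tuple R) : Prop :=
  (fun n => max_ratio (zeta n)) @ \oo --> (0 : R).

Definition sorted_array (t : nat -> R) (n : nat) : n.-tuple R :=
  [tuple of sort <=%R [tuple t i | i < n]].

Definition sequence_property_star (t : nat -> R) : Prop :=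
  property_star (sorted_array t).

End PropertyStar.

Section TransfiniteDiameter.
Variable R : realType.

Definition VDM n (a : 'I_n -> R[i]) : R[i] :=
  \det (Vandermonde n (\row_j a j)).

Definition VDM_root n (a : 'I_n -> R[i]) : R :=
  normc (VDM a) `^ (2 / (n * n.+1)%:R).

Definition diameter_n (K : set R[i]) (n : nat) : R :=
  sup [set VDM_root a | a in [set a : 'I_n -> R[i] | forall i, K (a i)]].

Definition transfinite_diameter (K : set R[i]) : R :=
  limn (diameter_n K).

End TransfiniteDiameter.

Section Interpolation.
Variable R : realType.
Implicit Types (a : nat -> R[i]) (f : R[i] -> R[i]) (K U : set R[i]).

Definition analytic_at f (z : R[i]) : Prop :=
  exists c : nat -> R[i], \forall w \near (z : R[i]^o),
    (series (fun k => c k * (w - z) ^+ k : R[i]^o)) @ \oo --> (f w : R[i]^o).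

Definition analytic_near f K : Prop :=
  exists U, [/\ open (U : set R[i]^o), K `<=` U
              & forall z, U z -> analytic_at f z].

Definition interpolates a f n : set {poly R[i]} :=
  [set p : {poly R[i]} | (size p <= n.+1)%N /\
     forall j, (j <= n)%N -> p.[a j] = f (a j)].

Lemma interpolates_unique a f n : injective a ->
  exists! p, interpolates a f n p.
Proof.
move=> ainj; pose L i : {poly R[i]} := tnth (lagrange n.+1 a) i.
pose p : {poly R[i]} := \sum_(i < n.+1) (f (a i))%:P * L i.
have La (i j : 'I_n.+1) : (L i).[a j] = (i == j)%:R by exact: lagrange_sample.
have pP : interpolates a f n p.
  split=> [|j jn].
    apply: (leq_trans (size_sum _ _ _)); apply/bigmax_leqP => i _.
    rewrite mul_polyC (leq_trans (size_scale_leq _ _)) //.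
    by rewrite /L size_lagrange_.
  pose j' : 'I_n.+1 := Ordinal (jn : (j < n.+1)%N).
  rewrite /p horner_sum (bigD1 j') //= big1 => [|i ij].
    by rewrite addr0 hornerM hornerC (La j' j') eqxx mulr1.
  by rewrite hornerM hornerC (La i j') (negPf ij) mulr0.
exists p; split=> // q [qsz qa].
rewrite (lagrange_gen (ltn0Sn n) ainj qsz); apply: eq_bigr => i _.
by rewrite qa // -ltnS.
Qed.

(* L_n f, "the unique polynomial such that ...". *)
Definition interpolant a f n : {poly R[i]} := xget 0 (interpolates a f n).

Definition good_for_interpolation K a : Prop :=
  [/\ injective a, (forall j, K (a j))
    & forall f, analytic_near f K ->
        {uniform (K : set R[i]^o),
          (fun n (z : R[i]^o) => (interpolant a f n).[z] : R[i]^o) @ \oo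
          --> (f : R[i]^o -> R[i]^o)}].

Definition unit_interval : set R[i] := [set x%:C | x in `[0 : R, 1]].

End Interpolation.

Arguments unit_interval R : clear implicits.

(* Main.v *)
Require Import Defs.
From HB Require Import structures.
From mathcomp Require Import all_boot all_order all_algebra.
From mathcomp Require Import all_classical all_reals all_analysis.
From mathcomp Require Import perm cyclic separable cyclotomic ring lra zify.
From mathcomp Require Import complex.

Set Implicit Arguments.
Unset Strict Implicit.
Unset Printing Implicit Defensive.

Import Order.TTheory GRing.Theory Num.Theory.
Import numFieldNormedType.Exports.
Import ComplexField.Normc.

Local Open Scope classical_set_scope.
Local Open Scope ring_scope.
Local Open Scope complex_scope.

(** Write p_n(x) = (x - t_0) ... (x - t_(n-1)) and v_n = 4^n |p_n(t_n)|; the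
    capacity of I = [0, 1] is 1/4.

    Transfinite diameter. If x lies between two adjacent nodes with midpoint m,
    then |p_n(x)| <= |p_n(m)| prod_k (1 + |x - m| / |m - t_k|), where the product
    is at most the exponential of n times the ratio of the half-gap to the
    harmonic distance at m. Property (star) makes this e^(o(n)), and t_n maximizes
    |p_n| over the midpoints; hence |p_n| <= e^(o(n)) |p_n(t_n)| on I
    ([node_prod_near_max]). A monic polynomial of degree n has sup norm at least
    4^-n / 2 on I ([monic_sup_lower_bound]), so ln v_n >= - o(n). On the other
    hand v_0 ... v_(n-1) = 4^(n(n-1)/2) |VDM_n| <= (n!)^2, because the Chebyshev
    polynomials U_k have leading coefficient 4^k and are bounded by k + 1 on I
    ([VDM_upper_bound]). So the sum of the ln v_k with k < n is o(n^2), and the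
    roots of |VDM_n| and of its maximum over I both tend to 1/4.

    Distribution of the nodes. Since |p_n| decreases with n on I, a single large
    ln v_n would force a whole block of large ones before it; hence
    ln v_n = o(n), and 4^n |p_n| = e^(o(n)) uniformly on I
    ([node_prod_subexponential]). Put y_k = 4 t_k - 2 and
    Q_n(w) = prod_(k < n) (1 - y_k w + w^2). On the unit circle |Q_n(w)| is
    4^n |p_n(x)|, where 4 x - 2 = w + 1/w; inside the disc Q_n has no zero and
    Q_n(0) = 1. Multiplying the values of Q_n at the m-th roots of a small number
    isolates the power sum sum_(k < n) V_m(y_k), where
    V_m(w + 1/w) = w^m + w^-m, and shows that it is o(n) for each m
    ([power_sum_small]). Newton's identities then give that the coefficients of
    1/Q_n, even with one more factor for a point x of I, are at most
    exp (eps (n + l)) in degree l, for every eps > 0 and n large ([recip_subexponential]). These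
    coefficients are exactly what governs the interpolation error of U_k
    ([chebU_poly_newton]). Hence interpolation at n + 1 nodes multiplies the sup
    norm of a polynomial of degree K by at most C exp (eps (n + K))
    ([interpolation_error_subexponential]).

    Analytic functions. A function analytic near I is approximated on I, with error
    O(2^-d), by polynomials of degree O(d): its local Taylor polynomials are glued
    together with Bernstein weights, whose tails are exponentially small
    ([geometric_approximation]). In the telescoping series of these approximations
    the geometric gain beats the slow exponential loss, so the interpolants
    converge uniformly ([interpolation_error_cvg]). *)

(** * Power series with quadratic denominators *)

Section ReciprocalSeries.
Variable A : comNzRingType.
Implicit Types (y z : A) (s : seq A) (a : nat -> A).

(** Division of the power series with coefficients a by 1 - y w + w^2. *)
Fixpoint quad_div y a l : A :=
  if l is l1.+1 then
    a l + y * quad_div y a l1 - (if l1 is l2.+1 then quad_div y a l2 else 0)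
  else a 0%N.

(** The coefficients of 1 / prod_(y <- s) (1 - y w + w^2), as a power series
    in w. When y = u + 1/u the factor is (1 - u w) (1 - w / u), so these are
    complete homogeneous symmetric functions of the pairs u, 1/u. *)
Definition recip s : nat -> A := foldr quad_div (fun l => (l == 0%N)%:R) s.

(** Chebyshev polynomials in the normalization y = 2 cos theta:
    chebU is sin ((k + 1) theta) / sin theta and chebV is 2 cos (m theta). *)
Definition chebU y : nat -> A := recip [:: y].

Fixpoint chebV y m : A :=
  if m is m1.+1 then
    if m1 is m2.+1 then y * chebV y m1 - chebV y m2 else y
  else 2.

Lemma quad_divSS y a l :
  quad_div y a l.+2 = a l.+2 + y * quad_div y a l.+1 - quad_div y a l.
Proof. by []. Qed.

Lemma chebVSS y m : chebV y m.+2 = y * chebV y m.+1 - chebV y m.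
Proof. by []. Qed.

Lemma chebUSS y k : chebU y k.+2 = y * chebU y k.+1 - chebU y k.
Proof. by rewrite /chebU /recip /= add0r. Qed.

Lemma nat_ind2 (P : nat -> Prop) :
  P 0%N -> P 1%N -> (forall l, P l -> P l.+1 -> P l.+2) -> forall l, P l.
Proof.
move=> P0 P1 PS l; suff: P l /\ P l.+1 by case.
by elim: l => [//|l [Pl Pl1]]; split=> //; apply: PS.
Qed.

Lemma recip0 s : recip s 0%N = 1.
Proof. by elim: s. Qed.

Lemma quad_div_diff y z a l :
  quad_div y a l.+1 - quad_div z a l.+1 =
  (y - z) * quad_div y (quad_div z a) l.
Proof.
elim/nat_ind2: l => [||l IH0 IH1].
- by rewrite /=; ring.
- by rewrite /=; ring.
rewrite [in RHS]quad_divSS mulrBr mulrDr [(y - z) * (y * _)]mulrCA -IH1 -IH0.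
by rewrite !(quad_divSS _ a); ring.
Qed.

(** Both sides come from the identity
    (1 - z w + w^2) - (1 - y w + w^2) = (y - z) w.  This is what makes divided
    differences of chebU explicit. *)
Lemma recip_diff y z s l :
  recip (y :: s) l.+1 - recip (z :: s) l.+1 = (y - z) * recip [:: y, z & s] l.
Proof. exact: quad_div_diff. Qed.

(** The power sum of degree m of all the u, 1/u with u + 1/u in s. *)
Definition power_sum s m : A := \sum_(y <- s) chebV y m.

(** The logarithmic derivative of 1 / (1 - y w + w^2) is the sum over m > 0 of
    chebV y m w^(m-1), whence Newton's identities between power sums and
    complete symmetric functions. *)
Lemma recip_newton s l :
  l%:R * recip s l = \sum_(i < l) power_sum s i.+1 * recip s (l - i.+1).
Proof.
elim: s l => [|y s IH] l.
  rewrite big1 => [|i _]; last by rewrite /power_sum big_nil mul0r.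
  by case: l => [|l]; rewrite /recip /= ?mul0r ?mulr0.
set B := recip (y :: s); set a := recip s in IH.
have BS0 : B 1%N = a 1%N + y * B 0%N by rewrite /B /= subr0.
have BSS k : B k.+2 = a k.+2 + y * B k.+1 - B k by [].
have B0 : B 0%N = 1 by exact: recip0.
have a0 : a 0%N = 1 by exact: recip0.
have cE m : power_sum (y :: s) m = chebV y m + power_sum s m.
  by rewrite /power_sum big_cons.
pose c := power_sum s.
pose Vs k := \sum_(i < k) chebV y i.+1 * B (k - i.+1)%N.
pose Cs k := \sum_(i < k) c i.+1 * B (k - i.+1)%N.
have VsSS k : Vs k.+2 = y * B k.+1 - 2 * B k + y * Vs k.+1 - Vs k.
  rewrite /Vs big_ord_recl big_ord_recl [in RHS]big_ord_recl.
  rewrite (eq_bigr (fun i : 'I_k => y * (chebV y i.+2 * B (k - i.+1)%N)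
    - chebV y i.+1 * B (k - i.+1)%N)); last first.
    move=> i _; rewrite !lift0 /= !subSS.
    by rewrite mulrBl -mulrA.
  rewrite sumrB -mulr_sumr.
  rewrite [X in _ + y * (_ + X)](eq_bigr (fun i : 'I_k =>
    chebV y i.+2 * B (k - i.+1)%N)); last first.
    by move=> i _; rewrite !lift0 /= !subSS.
  by rewrite !lift0 /= !subSS !subn0; ring.
have CsSS k : Cs k.+2 = k.+2%:R * a k.+2 + y * Cs k.+1 - Cs k.
  rewrite IH /Cs !big_ord_recr /= !subnn -/c.
  rewrite (_ : (k.+2 - k.+1 = 1)%N) ?BS0 ?B0 ?a0; last by lia.
  rewrite (eq_bigr (fun i : 'I_k => c i.+1 * a (k.+2 - i.+1)%N
     + y * (c i.+1 * B (k.+1 - i.+1)%N) - c i.+1 * B (k - i.+1)%N)); last first.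
    move=> i _; have ik := ltn_ord i.
    rewrite (_ : (k.+2 - i.+1 = (k - i.+1).+2)%N); last by lia.
    rewrite (_ : (k.+1 - i.+1 = (k - i.+1).+1)%N); last by lia.
    by rewrite BSS; ring.
  by rewrite sumrB big_split /= -mulr_sumr -/c; ring.
rewrite (eq_bigr (fun i : 'I_l =>
   chebV y i.+1 * B (l - i.+1)%N + c i.+1 * B (l - i.+1)%N)); last first.
  by move=> i _; rewrite cE mulrDl.
rewrite big_split /= -/(Vs l) -/(Cs l).
elim/nat_ind2: l => [||l IH0 IH1].
- by rewrite /Vs /Cs !big_ord0 mul0r addr0.
- rewrite /Vs /Cs !big_ord_recr !big_ord0 /= subnn BS0 B0.
  by have := IH 1%N; rewrite big_ord_recr big_ord0 /= subnn a0 -/c mul1r => ->; ring.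
rewrite VsSS CsSS BSS.
have -> : l.+2%:R * (a l.+2 + y * B l.+1 - B l) = l.+2%:R * a l.+2
  + y * (l.+1%:R * B l.+1) + y * B l.+1 - 2 * B l - l%:R * B l by ring.
by rewrite IH0 IH1; ring.
Qed.

(** Everything about chebV and chebU on [-2, 2] is read off the unit circle
    through these two closed forms. *)
Lemma chebV_unit y u v k : y = u + v -> u * v = 1 ->
  chebV y k = u ^+ k + v ^+ k.
Proof.
move=> -> uv; elim/nat_ind2: k => [||k IH0 IH1]; rewrite ?chebVSS.
- by rewrite /= !expr0.
- by rewrite /= !expr1.
have E : chebV (u + v) k = u * v * chebV (u + v) k by rewrite uv mul1r.
by rewrite E IH0 IH1 !exprS; ring.
Qed.

Lemma chebU_unit y u v k : y = u + v -> u * v = 1 ->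
  (u - v) * chebU y k = u ^+ k.+1 - v ^+ k.+1.
Proof.
move=> -> uv; elim/nat_ind2: k => [||k IH0 IH1]; rewrite ?chebUSS.
- by rewrite /chebU /= mulr1 !expr1.
- by rewrite /chebU /= !add0r subr0 mulr1; ring.
have -> : (u - v) * ((u + v) * chebU (u + v) k.+1 - chebU (u + v) k)
  = (u + v) * ((u - v) * chebU (u + v) k.+1)
    - u * v * ((u - v) * chebU (u + v) k) by rewrite uv; ring.
by rewrite IH0 IH1 !exprS; ring.
Qed.

Lemma chebU_chebV y k : chebU y k.+2 = chebU y k + chebV y k.+2.
Proof.
elim/nat_ind2: k => [||k IH0 IH1].
- by rewrite /chebU /recip /=; ring.
- by rewrite /chebU /recip /=; ring.
have V2 : chebV y k.+2 = chebU y k.+2 - chebU y k by rewrite IH0; ring.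
by rewrite (chebUSS y k.+2) IH1 (chebVSS y k.+2) V2 (chebUSS y k); ring.
Qed.

End ReciprocalSeries.

Lemma rmorph_recip (A B : comNzRingType) (f : {rmorphism A -> B}) (s : seq A) l :
  f (recip s l) = recip [seq f y | y <- s] l.
Proof.
elim: s l => [|y s IH] l; first by rewrite /recip /= rmorph_nat.
rewrite /=; set b := recip [seq f y | y <- s] in IH *.
elim/nat_ind2: l => [||l IH0 IH1].
- exact: IH.
- by rewrite /recip /= !subr0 rmorphD rmorphM -/(recip s) !IH.
rewrite (_ : f _ = f (recip s l.+2 + y * recip (y :: s) l.+1 - recip (y :: s) l))//.
by rewrite rmorphB rmorphD rmorphM IH IH0 IH1.
Qed.

Lemma rmorph_chebV (A B : comNzRingType) (f : {rmorphism A -> B}) y m :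
  f (chebV y m) = chebV (f y) m.
Proof.
elim/nat_ind2: m => [||m IH0 IH1] //; first by rewrite /= rmorph_nat.
by rewrite !chebVSS rmorphB rmorphM IH0 IH1.
Qed.

(** * Real-valued modulus and the unit circle *)

Section ComplexModulus.
Variable R : realType.
Implicit Types z w : R[i].

Lemma cabsE z : `|z| = (normc z)%:C.
Proof. by case: z => a b; rewrite normc_def. Qed.

Lemma cabs_ge0 z : 0 <= normc z.
Proof. by rewrite -ler0c -cabsE. Qed.

Lemma cabs_eq0 z : (normc z == 0) = (z == 0).
Proof. by apply/eqP/eqP => [/eq0_normc //|->]; rewrite normc0. Qed.

Lemma cabsD z w : normc (z + w) <= normc z + normc w.
Proof. by rewrite -lecR rmorphD /= -!cabsE ler_normD. Qed.

Lemma cabsN z : normc (- z) = normc z.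
Proof. by apply: complexI; rewrite -!cabsE normrN. Qed.

Lemma cabsB z w : normc (z - w) <= normc z + normc w.
Proof. by rewrite -(cabsN w) cabsD. Qed.

Lemma cabs_distC z w : normc (z - w) = normc (w - z).
Proof. by rewrite -opprB cabsN. Qed.

Lemma cabsM z w : normc (z * w) = normc z * normc w.
Proof. by apply: complexI; rewrite rmorphM /= -!cabsE normrM. Qed.

Lemma cabsX z n : normc (z ^+ n) = normc z ^+ n.
Proof. by apply: complexI; rewrite rmorphXn /= -!cabsE normrX. Qed.

Lemma cabsV z : normc z^-1 = (normc z)^-1.
Proof. exact: normcV. Qed.

Lemma cabs_real (x : R) : normc x%:C = `|x|.
Proof. by rewrite /= expr0n /= addr0 sqrtr_sqr. Qed.

Lemma cabs_sum I (r : seq I) (P : pred I) (F : I -> R[i]) :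
  normc (\sum_(i <- r | P i) F i) <= \sum_(i <- r | P i) normc (F i).
Proof.
by rewrite -lecR rmorph_sum /= -cabsE (le_trans (ler_norm_sum _ _ _)) //;
  apply: ler_sum => i _; rewrite cabsE.
Qed.

Lemma cabs_prod I (r : seq I) (P : pred I) (F : I -> R[i]) :
  normc (\prod_(i <- r | P i) F i) = \prod_(i <- r | P i) normc (F i).
Proof.
apply: complexI; rewrite rmorph_prod /= -cabsE normr_prod.
by apply: eq_bigr => i _; rewrite cabsE.
Qed.

Lemma prim_root_complex n : (0 < n)%N -> exists z : R[i], n.-primitive_root z.
Proof.
move=> n_gt0; pose p : {poly R[i]} := 'X^n - 1.
have [r Dp] := closed_field_poly_normal p.
rewrite (monicP _) ?monicXnsubC // scale1r in Dp.
have rn1: all n.-unity_root r by apply/allP=> z; rewrite -root_prod_XsubC -Dp.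
have sz_r: (n < (size r).+1)%N.
  by rewrite -(size_prod_XsubC r id) -Dp size_XnsubC.
have [|z] := hasP (has_prim_root n_gt0 rn1 _ sz_r); last by exists z.
rewrite -separable_prod_XsubC -Dp.
by rewrite separable_Xn_sub_1 // pnatr_eq0 -lt0n.
Qed.

Lemma prim_root_cabs n z : (0 < n)%N -> n.-primitive_root z -> normc z = 1.
Proof.
move=> n0 /prim_expr_order zn.
have /eqP : normc z ^+ n = 1 by rewrite -cabsX zn normc1.
by rewrite pexpr_eq1 ?cabs_ge0 // => /eqP.
Qed.

Lemma prim_root_sum_exp n z k : (0 < n)%N -> n.-primitive_root z -> ~~ (n %| k)%N ->
  \sum_(i < n) z ^+ (i * k) = 0.
Proof.
move=> n0 zn nk.
have zk : z ^+ k - 1 != 0 by rewrite subr_eq0 -(prim_order_dvd zn).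
apply: (mulfI zk); rewrite mulr0.
under eq_bigr => i _ do rewrite mulnC exprM.
by rewrite -subrX1 -exprM mulnC exprM (prim_expr_order zn) expr1n subrr.
Qed.

(** A coefficient is an average over the n-th roots of unity z of p(z) / z^j, as
    soon as n is at least the size of p. *)
Lemma coef_unit_circle (p : {poly R[i]}) (M : R) j :
  (forall w, normc w = 1 -> normc p.[w] <= M) -> normc p`_j <= M.
Proof.
move=> pM; have [jp|jp] := leqP (size p) j.
  rewrite nth_default // normc0.
  by apply: le_trans (pM 1 (normc1 _)); exact: cabs_ge0.
pose n := size p; have n0 : (0 < n)%N by rewrite (leq_ltn_trans _ jp).
have [z zn] := prim_root_complex n0.
have z1 := prim_root_cabs n0 zn.
(* The factor z^(i (n - j)) is z^(- i j), since z^n = 1. *)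
have zE : \sum_(i < n) p.[z ^+ i] * z ^+ (i * (n - j)) = n%:R * p`_j.
  under eq_bigr => i _ do rewrite horner_coef mulr_suml.
  rewrite exchange_big /= (bigD1 (Ordinal jp)) //= [X in _ + X]big1 => [|k kj].
    under eq_bigr => i _ do
      rewrite -exprM -mulrA -exprD -mulnDr subnKC 1?ltnW // mulnC exprM
              (prim_expr_order zn) expr1n mulr1.
    by rewrite sumr_const card_ord addr0 mulr_natl.
  under eq_bigr => i _ do rewrite -exprM -mulrA -exprD -mulnDr.
  rewrite -mulr_sumr prim_root_sum_exp ?mulr0 //.
  apply/negP => /dvdnP [q qE].
  have kj' : nat_of_ord k <> j by move=> E; case/eqP: kj; apply/val_inj.
  suff aux m a b c : (a < m)%N -> (b < m)%N -> a <> b ->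
      (a + (m - b) = c * m)%N -> False.
    by apply: (aux n k j q) => //; exact: ltn_ord.
  by move=> am bm ab; case: c => [|[|c]]; rewrite ?mul0n ?mul1n ?mulSn; lia.
have : normc (n%:R * p`_j) <= n%:R * M.
  rewrite -zE; apply: le_trans (cabs_sum _ _ _) _.
  rewrite -[leRHS](_ : \sum_(i < n) M = _); last first.
    by rewrite sumr_const card_ord mulr_natl.
  apply: ler_sum => i _.
  by rewrite cabsM cabsX z1 expr1n mulr1 pM // cabsX z1 expr1n.
by rewrite cabsM -(rmorph_nat (real_complex R)) cabs_real normr_nat ler_pM2l ?ltr0n.
Qed.

(** Evaluation of the factorization of X^n - 1 at 1/u. *)
Lemma prod_prim_root_factor n z (u : R[i]) : (0 < n)%N -> n.-primitive_root z ->
  \prod_(i < n) (1 - z ^+ i * u) = 1 - u ^+ n.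
Proof.
move=> n0 zn; have [->|u0] := eqVneq u 0.
  rewrite expr0n gtn_eqF // subr0 big1 // => i _; by rewrite mulr0 subr0.
have := congr1 (fun p => p.[u^-1]) (factor_Xn_sub_1 zn).
rewrite hornerD hornerXn hornerN hornerC horner_prod big_mkord.
move/(congr1 (fun x => u ^+ n * x)); rewrite mulrBr mulr1 -exprMn divff //.
rewrite expr1n => <-.
have -> : u ^+ n = \prod_(i < n) u by rewrite prodr_const card_ord.
rewrite -big_split /=.
apply: eq_bigr => i _; rewrite !hornerE mulrBr divff //; by rewrite mulrC.
Qed.

Lemma unit_circle_lift (y : R) : `|y| <= 2 ->
  exists u v : R[i], [/\ y%:C = u + v, u * v = 1, normc u = 1 & normc v = 1].
Proof.
move=> y2; have h : 0 <= 1 - (y / 2) ^+ 2.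
  by move: y2; rewrite ler_norml => /andP[? ?]; nra.
set s := Num.sqrt (1 - (y / 2) ^+ 2).
have s2 : s ^+ 2 = 1 - (y / 2) ^+ 2 by rewrite sqr_sqrtr.
exists ((y / 2) +i* s), ((y / 2) -i* s); split.
- by simpc; congr Complex; field.
- simpc; congr Complex; last by ring.
  transitivity ((y / 2) ^+ 2 + s ^+ 2); last by rewrite s2; ring.
  by ring.
- by rewrite /= s2 addrC subrK sqrtr1.
- by rewrite /= sqrrN s2 addrC subrK sqrtr1.
Qed.

End ComplexModulus.

(** * From power sums to coefficients *)

Section Growth.
Variable R : realType.

Lemma partial_exp_le (B : R) n : 0 <= B ->
  \sum_(j < n) B ^+ j / j`!%:R <= expR B.
Proof.
move=> B0.
have -> : \sum_(j < n) B ^+ j / j`!%:R = series (exp_coeff B) n.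
  by rewrite /series /= big_mkord.
apply: nondecreasing_cvgn_le; last exact: is_cvg_series_exp_coeff.
apply/nondecreasing_seqP => k; rewrite /series /= big_nat_recr //= lerDl.
exact: exp_coeff_ge0.
Qed.

(** Put g_k = |h_k| r^k. Newton's identities give k g_k <= B max_(j < k) g_j, a
    recursion satisfied by the partial sums S_k of the series of e^B, because
    B S_(k-1) = sum_(j <= k) j B^j / j! <= k S_k. *)
Lemma newton_bound (h c : nat -> R) (r B : R) l :
  0 <= r -> h 0%N = 1 ->
  (forall k, k%:R * h k = \sum_(i < k) c i.+1 * h (k - i.+1)%N) ->
  (forall k, \sum_(i < k) `|c i.+1| * r ^+ i.+1 <= B) ->
  `|h l| * r ^+ l <= expR B.
Proof.
move=> r0 h0 hN cB; have B0 : 0 <= B by have := cB 0%N; rewrite big_ord0.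
pose S n := \sum_(j < n.+1) B ^+ j / j`!%:R.
have Smono m n : (m <= n)%N -> S m <= S n.
  move=> mn; rewrite -(subnKC mn) /S -addSn big_split_ord /= lerDl.
  by apply: sumr_ge0 => i _; rewrite divr_ge0 ?exprn_ge0.
apply: le_trans (partial_exp_le l.+1 B0); rewrite -/(S l).
elim/ltn_ind: l => -[_|l IH].
  by rewrite h0 /S big_ord1 normr1 mul1r expr0 fact0 divr1.
rewrite -(ler_pM2l (_ : 0 < l.+1%:R)) ?ltr0n //.
have -> : l.+1%:R * (`|h l.+1| * r ^+ l.+1) = `|l.+1%:R * h l.+1| * r ^+ l.+1.
  by rewrite normrM normr_nat mulrA.
rewrite hN; apply: (@le_trans _ _ (B * S l)).
  apply: le_trans (_ : (\sum_(i < l.+1) `|c i.+1| * r ^+ i.+1) * S l <= _).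
    rewrite mulr_suml;
    apply: le_trans (_ : (\sum_(i < l.+1) `|c i.+1 * h (l.+1 - i.+1)%N|)
      * r ^+ l.+1 <= _).
      by rewrite ler_wpM2r ?exprn_ge0 // ler_norm_sum.
    rewrite mulr_suml; apply: ler_sum => i _; have il := ltn_ord i.
    rewrite normrM -[in r ^+ l.+1](subnKC il) exprD mulrACA ler_wpM2l ?mulr_ge0 ?exprn_ge0 //.
    apply: le_trans (IH _ _) (Smono _ _ _); by lia.
  by rewrite ler_wpM2r //; apply: sumr_ge0 => i _; rewrite divr_ge0 ?exprn_ge0.
rewrite /S mulr_sumr [leRHS]mulr_sumr [leRHS]big_ord_recl.
rewrite -[leLHS]add0r; apply: lerD; first by rewrite expr0 fact0 divr1 mulr1 ler0n.
apply: ler_sum => i _; rewrite lift0 factS natrM invfM exprS.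
have i0 : (i.+1%:R : R) != 0 by rewrite pnatr_eq0.
rewrite (_ : l.+1%:R * _ = (l.+1%:R / i.+1%:R) * (B * (B ^+ i / i`!%:R))); last by ring.
apply: ler_peMl; first by rewrite mulr_ge0 ?divr_ge0 ?exprn_ge0.
by rewrite ler_pdivlMr ?ltr0n // mul1r ler_nat ltn_ord.
Qed.

End Growth.

(** * Chebyshev expansions of polynomials on the unit interval *)

Section ChebyshevBasis.
Variable R : realType.
Implicit Types (x y : R) (P : {poly R[i]}).

(** The affine map from [0, 1] onto [-2, 2]; the points of [-2, 2] are the
    w + 1/w with w on the unit circle, and chart is 4 times a translation, 1/4
    being the capacity of [0, 1]. *)
Definition chart {A : comNzRingType} (x : A) : A := 4 * x - 2.

Lemma chart_bound x : 0 <= x <= 1 -> `|chart x| <= 2.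
Proof. by rewrite ler_norml /chart => /andP[? ?]; apply/andP; split; lra. Qed.

Lemma rmorph_chart (A B : comNzRingType) (f : {rmorphism A -> B}) (z : A) :
  f (chart z) = chart (f z).
Proof. by rewrite /chart rmorphB rmorphM !rmorph_nat. Qed.

Lemma chebV_bound y m : `|y| <= 2 -> `|chebV y m| <= 2.
Proof.
move=> /unit_circle_lift [u [v [yE uv u1 v1]]].
rewrite -cabs_real (rmorph_chebV (real_complex R)) (chebV_unit _ yE uv).
by apply: le_trans (cabsD _ _) _; rewrite !cabsX u1 v1 !expr1n.
Qed.

Lemma chebU_bound y k : `|y| <= 2 -> `|chebU y k| <= k.+1%:R.
Proof.
move=> y2; elim/nat_ind2: k => [||k IH0 _].
- by rewrite /chebU recip0 normr1.
- by rewrite /chebU /= add0r subr0 mulr1.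
rewrite chebU_chebV; apply: le_trans (ler_normD _ _) _.
apply: le_trans (lerD IH0 (chebV_bound _ y2)) _.
by rewrite -natrD addn2.
Qed.

Definition chebU_poly k : {poly R[i]} := chebU (chart 'X) k.

Lemma chart_polyE : chart 'X = 4%:P * 'X - 2%:P :> {poly R[i]}.
Proof. by rewrite /chart !polyCMn. Qed.

Lemma horner_recip (s : seq {poly R[i]}) l z :
  (recip s l).[z] = recip [seq p.[z] | p <- s] l.
Proof. exact: (rmorph_recip (horner_eval z)). Qed.

Lemma horner_chart z : (chart 'X : {poly R[i]}).[z] = chart z.
Proof. by rewrite chart_polyE !hornerE. Qed.

Lemma horner_chebU k z : (chebU_poly k).[z] = chebU (chart z) k.
Proof. by rewrite /chebU_poly /chebU horner_recip /= horner_chart. Qed.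

(** The leading coefficient 4^k, compared with the bound k + 1 on the values, is
    where the capacity 1/4 of the interval comes from. *)
Lemma chebU_poly_spec k :
  (size (chebU_poly k) <= k.+1)%N /\ (chebU_poly k)`_k = 4 ^+ k.
Proof.
have coefY (p : {poly R[i]}) j : (chart 'X * p)`_j.+1 = 4 * p`_j - 2 * p`_j.+1.
  by rewrite chart_polyE mulrBl -mulrA coefB !coefCM coefXM.
rewrite /chebU_poly; elim/nat_ind2: k => [||k [sz0 _] [sz1 c1]].
- by rewrite /chebU recip0 size_poly1 coefC.
- have -> : chebU (chart 'X) 1 = chart 'X * 1 :> {poly R[i]}.
    by rewrite /chebU /= add0r subr0.
  rewrite coefY !coefC /= mulr0 subr0 !mulr1 expr1; split=> //.
  rewrite chart_polyE; apply/leq_sizeP => j j2.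
  rewrite coefB coefCM coefX coefC; case: j j2 => [|[|j]] //= _.
  by rewrite mulr0 subr0.
rewrite chebUSS; split.
  apply/leq_sizeP => -[|j] // jk; rewrite coefB coefY.
  by rewrite !nth_default ?mulr0 ?subr0 //; move: sz0 sz1 jk;
    move: (size _) (size _) => ? ?; lia.
by rewrite coefB coefY c1 !nth_default ?mulr0 ?subr0 ?exprS // (leq_trans sz0).
Qed.

Lemma chebU_poly_expansion P K : (size P <= K.+1)%N ->
  exists a : nat -> R[i], P = \sum_(k < K.+1) a k *: chebU_poly k.
Proof.
elim: K P => [|K IH] P szP.
  exists (fun=> P`_0); rewrite big_ord1 /chebU_poly /chebU recip0 -mul_polyC mulr1.
  by rewrite [LHS]size1_polyC.
pose c := P`_K.+1 / 4 ^+ K.+1.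
have [sU cU] := chebU_poly_spec K.+1.
have [|a aP] := IH (P - c *: chebU_poly K.+1).
  apply/leq_sizeP => j; rewrite leq_eqVlt => /orP[/eqP <-|jK].
    by rewrite coefB coefZ cU /c divfK ?subrr // expf_neq0.
  by rewrite coefB coefZ !nth_default ?mulr0 ?subr0 //; apply: leq_trans jK.
exists (fun k => if k == K.+1 then c else a k).
rewrite big_ord_recr /= eqxx -[LHS](subrK (c *: chebU_poly K.+1)) aP.
congr (_ + _); apply: eq_bigr => i _; by rewrite ltn_eqF.
Qed.

Lemma unit_circle_interval (w : R[i]) : normc w = 1 ->
  exists x : R, 0 <= x <= 1 /\ chart x%:C = w + w^-1.
Proof.
case: w => a b w1; have ab : a ^+ 2 + b ^+ 2 = 1.
  have := congr1 (fun z => z ^+ 2) w1.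
  by rewrite /= sqr_sqrtr ?expr1n // addr_ge0 ?sqr_ge0.
exists ((a + 1) / 2); split; first by apply/andP; split; nra.
have w0 : a +i* b != 0 by rewrite -cabs_eq0 w1 oner_eq0.
have -> : (a +i* b)^-1 = a -i* b.
  apply: (mulfI w0); rewrite divff //; simpc.
  by congr Complex; rewrite -?ab; ring.
rewrite -(rmorph_chart (real_complex R)) /chart; simpc.
by congr Complex; field.
Qed.

(** Multiplied by w - 1/w, the polynomial at (w + 1/w + 2) / 4 becomes
    sum_j a_j (w^(j+1) - w^(-j-1)); thus a_k is a coefficient of a polynomial in
    w bounded by 2 M on the unit circle. *)
Lemma chebU_coef_bound (a : nat -> R[i]) K M k :
  (forall x, 0 <= x <= 1 ->
     normc (\sum_(k < K.+1) a k *: chebU_poly k).[x%:C] <= M) ->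
  (k <= K)%N -> normc (a k) <= 2 * M.
Proof.
move=> aM kK.
(* Q is w^(K+1) (w - 1/w) times the given polynomial at (w + 1/w + 2) / 4. *)
pose Q : {poly R[i]} :=
  \sum_(j < K.+1) a j *: ('X^(K.+1 + j.+1) - 'X^(K - j)).
have Qk : Q`_(K.+1 + k.+1) = a k.
  rewrite /Q coef_sum (bigD1 (Ordinal (kK : (k < K.+1)%N))) //= big1.
    rewrite coefZ coefB !coefXn eqxx gtn_eqF ?subr0 ?mulr1 ?addr0 //; lia.
  move=> j jk; rewrite coefZ coefB !coefXn eqn_add2l eqSS.
  rewrite [_ == (K - j)%N]gtn_eqF; last by lia.
  case: eqP => [E|_]; last by rewrite subr0 mulr0.
  by case/eqP: jk; apply/val_inj.
rewrite -Qk; apply: coef_unit_circle => w w1.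
have w0 : w != 0 by rewrite -cabs_eq0 w1 oner_eq0.
have [x [x01 xw]] := unit_circle_interval w1.
have -> : Q.[w] = w ^+ K.+1 * (w - w^-1) *
    (\sum_(k < K.+1) a k *: chebU_poly k).[x%:C].
  rewrite /Q !horner_sum mulr_sumr; apply: eq_bigr => j _.
  rewrite !hornerZ hornerD hornerN !hornerXn horner_chebU mulrCA -mulrA (chebU_unit _ xw) ?divff //.
  congr (_ * _); rewrite mulrBr -exprD; congr (_ - _).
  rewrite exprVn; have jK : (j <= K)%N by rewrite -ltnS.
  have -> : w ^+ K.+1 = w ^+ (K - j) * w ^+ j.+1 by rewrite -exprD; congr (_ ^+ _); lia.
  by rewrite mulfK // expf_neq0.
rewrite !cabsM cabsX w1 expr1n mul1r ler_pM ?cabs_ge0 ?aM //.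
by apply: le_trans (cabsB _ _) _; rewrite cabsV w1 invr1.
Qed.

(** The coefficient of a monic polynomial of degree n on chebU_poly n is 4^-n. *)
Lemma monic_sup_lower_bound P n M : P \is monic -> size P = n.+1 ->
  (forall x, 0 <= x <= 1 -> normc P.[x%:C] <= M) -> (4 ^+ n)^-1 <= 2 * M.
Proof.
move=> /monicP lP sP PM; have [|a aP] := @chebU_poly_expansion P n; first by rewrite sP.
have an : a n = (4 ^+ n)^-1.
  have : P`_n = 1 by rewrite -lP lead_coefE sP.
  rewrite aP coef_sum big_ord_recr /= big1 => [|i _]; last first.
    have [sU _] := chebU_poly_spec i.
    by rewrite coefZ nth_default ?mulr0 // (leq_trans sU).
  have [_ cU] := chebU_poly_spec n.
  rewrite add0r coefZ cU => /(canRL (mulfK _)) ->; first by rewrite div1r.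
  by rewrite expf_neq0.
have := @chebU_coef_bound a n M n; rewrite an -aP => /(_ PM (leqnn _)).
rewrite cabsV cabsX -(rmorph_nat (real_complex R) 4) cabs_real.
by rewrite normr_nat.
Qed.

(** Row operations replace the monomials by the polynomials chebU_poly k, which
    multiplies the determinant by the product of their leading coefficients 4^k;
    each of the n! terms of the new determinant is at most prod_k (k + 1) = n!. *)
Lemma VDM_upper_bound n (a : 'I_n -> R[i]) :
  (forall i, exists2 x : R, 0 <= x <= 1 & a i = x%:C) ->
  normc (VDM a) * \prod_(k < n) 4 ^+ k <= n`!%:R ^+ 2.
Proof.
move=> aI.
pose L : 'M[R[i]]_n := \matrix_(i, j) (chebU_poly i)`_j.
have Lt : is_trig_mx L.
  apply/is_trig_mxP => i j ij; rewrite mxE nth_default //.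
  by have [sU _] := chebU_poly_spec i; rewrite (leq_trans sU).
pose W := L *m Vandermonde n (\row_j a j).
have WE i j : W i j = chebU (chart (a j)) i.
  rewrite mxE -horner_chebU (horner_coef_wide _ (_ : (size _ <= n)%N)).
    by apply: eq_bigr => k _; rewrite !mxE.
  by have [sU _] := chebU_poly_spec i; rewrite (leq_trans sU).
have dW : normc (\det W) = normc (VDM a) * \prod_(k < n) 4 ^+ k.
  rewrite det_mulmx cabsM mulrC; congr (_ * _).
  rewrite det_trig // cabs_prod; apply: eq_bigr => i _.
  have [_ cU] := chebU_poly_spec i.
  by rewrite mxE cU cabsX -(rmorph_nat (real_complex R) 4) cabs_real normr_nat.
rewrite -dW; apply: le_trans (cabs_sum _ _ _) _.
have -> : n`!%:R ^+ 2 = \sum_(s : {perm 'I_n}) n`!%:R :> R.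
  by rewrite sumr_const card_Sn expr2 mulr_natr.
apply: ler_sum => s _; rewrite cabsM cabsX cabsN normc1 expr1n mul1r cabs_prod.
rewrite fact_prod natr_prod big_add1 big_mkord; apply: ler_prod => i _.
rewrite cabs_ge0 WE; have [x x01 ->] := aI (s i).
rewrite -(rmorph_chart (real_complex R)).
have := rmorph_recip (real_complex R) [:: chart x] i; rewrite /chebU /= => <-.
by rewrite cabs_real chebU_bound ?chart_bound.
Qed.

End ChebyshevBasis.

(** * The interpolation error of a polynomial *)

Section InterpolationError.
Variable R : realType.
Implicit Types (t : nat -> R) (P : {poly R[i]}).

Definition node_charts t n : seq R := [seq chart (t i) | i <- iota 0 n].

Lemma big_node_charts (A : comNzRingType) (F : R -> A) t n :
  \prod_(y <- node_charts t n) F y = \prod_(i < n) F (chart (t i)).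
Proof. by rewrite big_map -{1}(subn0 n) -/(index_iota 0 n) big_mkord. Qed.

(** Newton interpolation of chebU_poly k at the nodes y in s, one node at a time:
    recip_diff turns the remainder for s into a constant, which goes into Q, plus
    the remainder for one more node. *)
Lemma chebU_poly_newton (s : seq R[i]) k : exists Q : {poly R[i]},
  (size Q <= size s)%N /\
  chebU_poly R k = Q + \prod_(y <- s) (chart 'X - y%:P) *
    (if (size s <= k)%N then recip (chart 'X :: map polyC s) (k - size s)
     else 0).
Proof.
elim: s => [|z s [Q [sQ QE]]].
  by exists 0; rewrite size_poly0 big_nil mul1r add0r subn0.
have [skz|ks] := boolP (size (z :: s) <= k)%N; last first.
  exists (chebU_poly R k); rewrite mulr0 addr0.
  split=> //.
  by have [sU _] := chebU_poly_spec R k; rewrite (leq_trans sU) // ltnNge.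
have sk : (size s < k)%N by [].
set c := recip (z :: s) (k - size s).
exists (Q + \prod_(y <- s) (chart 'X - y%:P) * c%:P); split.
  apply: leq_trans (size_polyD _ _) _; rewrite geq_max (leq_trans sQ) //=.
  rewrite mulrC mul_polyC (leq_trans (size_scale_leq _ _)) //.
  have sf (y : R[i]) : (size (chart 'X - y%:P)%R <= 2)%N.
    rewrite chart_polyE; apply/leq_sizeP => j j2.
    rewrite !coefB coefCM coefX !coefC; case: j j2 => [|[|j]] //= _.
    by rewrite mulr0 !subr0.
  elim: (s) => [|y r IH]; first by rewrite big_nil size_poly1.
  rewrite big_cons (leq_trans (size_polyMleq _ _)) //=.
  by rewrite -subn1 leq_subLR (leq_trans (leq_add (sf y) IH)).
rewrite QE (ltnW sk) big_cons -addrA; congr (Q + _).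
have [j kj] : exists j, (k - size s = j.+1)%N by exists (k - size s).-1; lia.
have -> : (k - size (z :: s) = j)%N by rewrite /=; lia.
have cE : recip (z%:P :: map polyC s) (k - size s) = c%:P.
  exact: (esym (rmorph_recip polyC (z :: s) (k - size s))).
have := recip_diff (chart 'X) z%:P (map polyC s) j; rewrite -kj cE.
move=> /eqP; rewrite subr_eq => /eqP ->.
by rewrite mulrDr addrC [(chart 'X - z%:P) * \prod_(_ <- _) _]mulrC -mulrA.
Qed.

Lemma interpolantE (a : nat -> R[i]) f n p : injective a ->
  interpolates a f n p -> interpolant a f n = p.
Proof.
move=> ainj pI; have [q [_ qU]] := interpolates_unique f n ainj.
by apply: xget_unique => // r rI; rewrite -(qU _ pI) (qU _ rI).
Qed.

(** Expand P on the Chebyshev basis, with coefficients at most 2 d, and apply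
    chebU_poly_newton to each term: the error of the k-th one at x is the
    node polynomial, scaled by 4^(n+1), times a coefficient of
    1 / prod (1 - y w + w^2) over x and the nodes. *)
Lemma interpolation_error_bound t n K P x (d W H : R) :
  injective t -> (size P <= K.+1)%N -> 0 <= x <= 1 ->
  (forall z : R, 0 <= z <= 1 -> normc P.[z%:C] <= d) ->
  4 ^+ n.+1 * `|node_prod t n.+1 x| <= W ->
  (forall l, (l <= K)%N ->
     `|recip (chart x :: node_charts t n.+1) l| <= H) ->
  normc (P.[x%:C] -
    (interpolant (fun j => (t j)%:C) (fun z => P.[z]) n).[x%:C]) <=
  K.+1%:R * (2 * d) * (W * H).
Proof.
move=> tinj szP x01 Pd xW xH.
have [a aP] := chebU_poly_expansion szP.
pose s := map (real_complex R) (node_charts t n.+1).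
have ss : size s = n.+1 by rewrite /s !size_map size_iota.
have [Q QP] := choice (chebU_poly_newton s).
pose G k := if (size s <= k)%N then recip (chart 'X :: map polyC s) (k - size s)
            else 0 : {poly R[i]}.
pose N := \prod_(y <- s) (chart 'X - y%:P) : {poly R[i]}.
have NE z : N.[z] = \prod_(i < n.+1) (4 * (z - (t i)%:C)).
  rewrite horner_prod big_map big_node_charts; apply: eq_bigr => i _.
  rewrite hornerD horner_chart hornerN hornerC rmorph_chart /chart; ring.
pose L := \sum_(k < K.+1) a k *: Q k.
have PE : P = L + N * \sum_(k < K.+1) a k *: G k.
  rewrite aP mulr_sumr -big_split /=; apply: eq_bigr => k _.
  by have [_ {1}->] := QP k; rewrite scalerDr scalerAr.
have -> : interpolant (fun j => (t j)%:C) (fun z => P.[z]) n = L.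
  apply: interpolantE => [i j [] /tinj //|]; split=> [|j jn].
    apply/leq_sizeP => j jn; rewrite coef_sum big1 // => k _.
    have [sQ _] := QP k; rewrite coefZ nth_default ?mulr0 //.
    by rewrite (leq_trans sQ) // ss.
  rewrite PE hornerD hornerM NE (bigD1 (Ordinal (jn : (j < n.+1)%N))) //=.
  by rewrite subrr mulr0 !mul0r addr0.
rewrite PE hornerD addrC addKr hornerM mulrC cabsM.
have d0 : 0 <= d by apply: le_trans (Pd _ x01); exact: cabs_ge0.
have H0 : 0 <= H by apply: le_trans (xH 0%N _).
have -> : K.+1%:R * (2 * d) * (W * H) = (K.+1%:R * (2 * d) * H) * W by ring.
apply: ler_pM; rewrite ?cabs_ge0 //; last first.
  apply: le_trans xW; rewrite NE cabs_prod /node_prod normr_prod.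
  have -> : (4 : R) ^+ n.+1 = \prod_(i < n.+1) 4 by rewrite prodr_const card_ord.
  rewrite -big_split le_eqVlt; apply/orP; left; apply/eqP.
  apply: eq_bigr => i _.
  by rewrite cabsM -rmorphB cabs_real -(rmorph_nat (real_complex R)) cabs_real normr_nat.
rewrite horner_sum; apply: le_trans (cabs_sum _ _ _) _.
have -> : K.+1%:R * (2 * d) * H = \sum_(k < K.+1) (2 * d) * H.
  by rewrite sumr_const card_ord -[RHS]mulr_natl; ring.
apply: ler_sum => k _; rewrite hornerZ cabsM ler_pM ?cabs_ge0 //.
  by apply: (@chebU_coef_bound _ a K); rewrite -?aP // -ltnS.
rewrite /G; case: ifP => _; last by rewrite horner0 normc0.
have sE : [seq p.[x%:C] | p <- map polyC s] = s.
  by rewrite -map_comp map_id_in // => z _ /=; rewrite hornerC.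
rewrite horner_recip map_cons sE horner_chart -(rmorph_chart (real_complex R)).
have := rmorph_recip (real_complex R) (chart x :: node_charts t n.+1).
move=> /= <-; rewrite cabs_real xH //.
by rewrite (leq_trans (leq_subr _ _)) // -ltnS.
Qed.

End InterpolationError.

(** * Fast Leja points and the midpoint property *)

Section FastLejaStructure.
Variable R : realType.
Implicit Types (t : nat -> R) (S : nat -> set R) (x : R).

Lemma fast_leja_bounds t : fast_leja_sequence t -> forall n, 0 <= t n <= 1.
Proof.
move=> [S [t0 t1 S1 step]]; elim/ltn_ind => -[|[|n]] IH.
- by rewrite t0 lexx ler01.
- by rewrite t1 lexx ler01.
have [//|_ _ [l [r [[[i ilt <-] [j jlt <-] /andP[lt rt] _] _]]]] := step n.+2.
have /andP[i0 _] := IH i ilt; have /andP[_ j1] := IH j jlt.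
by rewrite (le_trans i0 (ltW lt)) (le_trans (ltW rt) j1).
Qed.

Lemma fast_leja_injective t : fast_leja_sequence t -> injective t.
Proof.
move=> [S [t0 t1 S1 step]].
have main i j : (i < j)%N -> t i <> t j.
  case: j => [//|[|j]] ij.
    by move: ij; rewrite ltnS leqn0 => /eqP ->; rewrite t0 t1 => /eqP;
      rewrite eq_sym oner_eq0.
  have [//|_ _ [l [r [[_ _ /andP[lt rt] adj] _]]]] := step j.+2 => E.
  have := adj (t i); rewrite E => /(_ (ex_intro2 _ _ i ij E)).
  by case=> h; [have := lt_le_trans lt h|have := lt_le_trans rt h]; rewrite ltxx.
move=> i j E; case: (ltngtP i j) => // ij; first by case: (main _ _ ij).
by case: (main _ _ ij).
Qed.

(** By induction on the stage: a new pair of adjacent points has the new node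
    as one of its ends, and its other end is then a neighbour of that node in the
    previous stage. *)
Lemma candidates_contain_midpoints t S n :
  t 0%N = 0 -> t 1%N = 1 -> S 1%N = [set 2^-1] ->
  (forall m, (2 <= m)%N -> fast_leja_step t S m) -> (0 < n)%N ->
  forall l r, first_points t n.+1 l -> first_points t n.+1 r -> l < r ->
    (forall y, first_points t n.+1 y -> y <= l \/ r <= y) -> S n ((l + r) / 2).
Proof.
move=> t0 t1 S1 step; elim: n => [//|[|n] IH] _ l r.
  case=> [[|[|//]] _ <-] [[|[|//]] _ <-]; rewrite ?t0 ?t1 ?ltxx ?ltr10 // S1 => _ _.
  by rewrite add0r div1r.
have [//|_ _ [l0 [r0 [[l0T r0T /andP[lt rt] adj0] ->]]]] := step n.+2.
have split_last y : first_points t n.+3 y -> first_points t n.+2 y \/ y = t n.+2.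
  case=> i /=; rewrite ltnS leq_eqVlt => /orP[/eqP -> <-|iN <-]; first by right.
  by left; exists i.
have wid y : first_points t n.+2 y -> first_points t n.+3 y.
  by case=> i /= iN <-; exists i => //=; apply: ltnW.
have lastT : first_points t n.+3 (t n.+2) by exists n.+2 => /=.
move=> lT rT lr adj; have := split_last _ lT; have := split_last _ rT.
case=> [rT'|rE] [lT'|lE].
- left; split=> [|E].
    apply: IH => // y yT; exact: adj (wid _ yT).
  case: (adj _ lastT) => h; move: h; rewrite -E.
    by move=> h; lra.
  by move=> h; lra.
- have -> : r = r0.
    apply/eqP; rewrite eq_le; apply/andP; split.
      case: (adj _ (wid _ r0T)) => //; rewrite lE => h; exfalso; lra.
    case: (adj0 _ rT') => // h; exfalso; lra.
  by right; right; rewrite lE.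
- have -> : l = l0.
    apply/eqP; rewrite eq_le; apply/andP; split.
      case: (adj0 _ lT') => // h; exfalso; lra.
    case: (adj _ (wid _ l0T)) => //; rewrite rE => h; exfalso; lra.
  by right; left; rewrite rE.
- by move: lr; rewrite lE rE ltxx.
Qed.

Lemma bracketing_interval (z : nat -> R) m x : (0 < m)%N -> z 0%N <= x -> x <= z m ->
  exists2 j, (j < m)%N & z j <= x <= z j.+1.
Proof.
elim: m => [//|m IH] _ z0 zm; have [h|h] := leP (z m) x.
  by exists m => //; rewrite h zm.
case: m => [|m] in IH zm h *; first by move: h; rewrite ltNge z0.
by have [//|j jm jx] := IH _ z0 (ltW h); exists j => //; apply: ltnW.
Qed.

Section SortedArray.
Variables (t : nat -> R) (n : nat).
Let zeta := sorted_array t n.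

Lemma sorted_array_perm : perm_eq zeta [seq t i | i <- iota 0 n].
Proof.
rewrite /zeta /sorted_array /= (perm_trans (permEl (perm_sort _ _))) //=.
by rewrite -val_enum_ord -map_comp.
Qed.

Lemma sorted_array_prod x : node_prod t n x = \prod_(k < n) (x - zeta`_k).
Proof.
have -> : node_prod t n x = \prod_(y <- [seq t i | i <- iota 0 n]) (x - y).
  by rewrite big_map -{2}(subn0 n) -/(index_iota 0 n) big_mkord.
rewrite -(perm_big _ sorted_array_perm) (big_nth 0) big_mkord.
by rewrite size_tuple.
Qed.

Lemma sorted_array_le i j : (i <= j < n)%N -> zeta`_i <= zeta`_j.
Proof.
move=> /andP[ij jn].
have szt : sorted <=%R zeta by rewrite /zeta /= sort_sorted //; exact: le_total.
apply: (sorted_leq_nth le_trans le_refl 0 szt) => //; rewrite inE size_tuple //.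
exact: leq_ltn_trans jn.
Qed.

Lemma sorted_array_lt i j : injective t -> (i < j < n)%N -> zeta`_i < zeta`_j.
Proof.
move=> tinj /andP[ij jn].
rewrite lt_neqAle sorted_array_le ?(ltnW ij) // andbT.
rewrite nth_uniq ?size_tuple ?(ltn_trans ij) //; first by rewrite ltn_eqF.
by rewrite (perm_uniq sorted_array_perm) map_inj_uniq ?iota_uniq.
Qed.

Lemma sorted_arrayP y : first_points t n y <-> exists2 i, (i < n)%N & y = zeta`_i.
Proof.
have memE x : (x \in (zeta : seq R)) = (x \in [seq t i | i <- iota 0 n]).
  exact: (perm_mem sorted_array_perm).
split=> [[i /= iN <-]|[i iN ->]].
  have : t i \in (zeta : seq R) by rewrite memE map_f // mem_iota.
  by case/(nthP 0) => k; rewrite size_tuple => kn <-; exists k.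
have : zeta`_i \in (zeta : seq R) by rewrite mem_nth // size_tuple.
by rewrite memE => /mapP [k]; rewrite mem_iota => kn ->; exists k.
Qed.

End SortedArray.

(** By the triangle inequality each factor |x - z_k| is at most
    |m - z_k| (1 + |x - m| / |m - z_k|), and 1 + a <= e^a. *)
Lemma prod_dist_compare n (z : nat -> R) (m x : R) :
  (forall k, (k < n)%N -> m != z k) ->
  \prod_(k < n) `|x - z k| <=
  expR (`|x - m| * \sum_(k < n) `|m - z k|^-1) * \prod_(k < n) `|m - z k|.
Proof.
move=> mz; rewrite mulr_sumr expR_sum -big_split /=; apply: ler_prod => k _.
rewrite normr_ge0 /=.
have mk : 0 < `|m - z k| by rewrite normr_gt0 subr_eq0 mz.
apply: le_trans (_ : (1 + `|x - m| * `|m - z k|^-1) * `|m - z k| <= _).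
  rewrite mulrDl mul1r divfK ?gt_eqF //.
  have -> : x - z k = (m - z k) + (x - m) by ring.
  exact: ler_normD.
by rewrite ler_wpM2r ?expR_ge1Dx.
Qed.

(** Compare x with the midpoint m of a pair of adjacent nodes around it: the
    exponent in prod_dist_compare is then at most n times the ratio of the
    half-gap to the harmonic distance, and m is a candidate for the next node. *)
Lemma fast_leja_near_max t n x : fast_leja_sequence t -> (2 <= n)%N ->
  0 <= x <= 1 ->
  `|node_prod t n x| <=
  expR (n%:R * max_ratio (sorted_array t n)) * `|node_prod t n (t n)|.
Proof.
move=> tL n2 /andP[x0 x1]; have tinj := fast_leja_injective tL.
have [S [t0 t1 S1 step]] := tL; have [_ tmax _] := step n n2.
pose z j := (sorted_array t n)`_j.
have n1 : (n = n.-1.+1)%N by lia.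
have z0 : z 0%N <= x.
  have [|i iN E] := (sorted_arrayP t n 0).1; first by exists 0%N => //=; lia.
  by apply: le_trans x0; rewrite E sorted_array_le.
have zn : x <= z n.-1.
  have [|i iN E] := (sorted_arrayP t n 1).1; first by exists 1%N => //=; lia.
  by apply: le_trans x1 _; rewrite E sorted_array_le //; lia.
have [|j jn /andP[zj zj1]] := @bracketing_interval z n.-1 x _ z0 zn; first by lia.
have jn1 : (j.+1 < n)%N by lia.
have zlt : z j < z j.+1 by rewrite sorted_array_lt ?ltnSn.
have zsep i : (i < n)%N -> z i <= z j \/ z j.+1 <= z i.
  move=> iN; have [ij|ij] := leqP i j; [left|right];
    by rewrite sorted_array_le ?ij ?iN //; lia.
pose m := mid (sorted_array t n) j.
have mE : m = (z j + z j.+1) / 2 by [].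
have Sm : S n.-1 m.
  apply: (candidates_contain_midpoints t0 t1 S1 step) => //; try lia;
    rewrite -?n1; [| |move=> y].
  - by apply/sorted_arrayP; exists j => //; lia.
  - by apply/sorted_arrayP; exists j.+1.
  by case/sorted_arrayP => i iN ->; exact: zsep.
have mz k : (k < n)%N -> m != z k.
  move=> /zsep kz; apply/negP => /eqP E; move: kz; rewrite -E mE => -[]; lra.
have := @prod_dist_compare n z m x mz.
rewrite !sorted_array_prod !normr_prod => /le_trans; apply.
rewrite -!normr_prod -!sorted_array_prod.
apply: ler_pM; rewrite ?expR_ge0 //; last exact: tmax.
rewrite ler_expR.
apply: le_trans (_ : n%:R * (half_gap (sorted_array t n) j /
  harmonic_dist (sorted_array t n) j) <= _); last first.
  rewrite ler_wpM2l // /max_ratio; exact: (le_bigmax _ _ (Ordinal jn)).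
rewrite /harmonic_dist invrK [leRHS]mulrCA [n%:R * _]mulVKf; last by rewrite pnatr_eq0; lia.
apply: ler_wpM2r; first by apply: sumr_ge0 => k _; rewrite invr_ge0.
rewrite /half_gap -/m -/(z j) ler_norml; apply/andP; split.
  by rewrite ger0_norm mE; lra.
by rewrite ger0_norm mE; lra.
Qed.

End FastLejaStructure.

(** * Second-order asymptotics *)

Section Asymptotics.
Variable R : realType.
Implicit Types (s : nat -> R).

Lemma near_ge_nat (r : R) : \forall n \near \oo, r <= n%:R.
Proof. exact: ((cvgryPge _).1 cvgr_idn r). Qed.

Lemma factorial_le_expn n : (n`! <= n ^ n)%N.
Proof.
elim: n => [//|n IH]; rewrite factS expnS leq_mul2l (leq_trans IH) ?orbT //.
by case: n {IH} => [//|n]; rewrite leq_exp2r.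
Qed.

Lemma ln_le_sublinear (e r : R) : 0 < e -> 0 < r -> ln r <= e * r - ln e.
Proof.
move=> e0 r0; rewrite lerBrDl -lnM ?posrE //.
by apply/ltW/ln_sublinear; rewrite mulr_gt0.
Qed.

Lemma ln_factorial_small (e : R) : 0 < e ->
  \forall n \near \oo, 2 * ln (n`!%:R : R) <= e * n%:R ^+ 2.
Proof.
move=> e0; near=> n.
have n1 : 1 <= n%:R :> R by near: n; exact: near_ge_nat.
have n0 : 0 < n%:R :> R by rewrite (lt_le_trans _ n1).
have lf : ln (n`!%:R : R) <= n%:R * ln n%:R.
  rewrite mulr_natl -lnXn // ler_ln ?posrE ?exprn_gt0 // ?ltr0n ?fact_gt0 //.
  by rewrite -natrX ler_nat factorial_le_expn.
have e4 : 0 < e / 4 by rewrite divr_gt0.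
have ll := ln_le_sublinear e4 n0.
have lN : - ln (e / 4) <= e / 4 * n%:R.
  rewrite -ler_pdivrMl //; near: n; exact: near_ge_nat.
have : n%:R * ln n%:R <= n%:R * (e / 2 * n%:R).
  by rewrite ler_pM2l //; lra.
by move=> h; rewrite (_ : e * n%:R ^+ 2 = 2 * (n%:R * (e / 2 * n%:R))); [lra|field].
Unshelve. all: by end_near. Qed.

(** The exponent is 2 s_n / (n (n + 1)) - ln 4 (n - 1) / (n + 1). *)
Lemma quarter_root_cvg s :
  (forall e, 0 < e -> \forall n \near \oo, `|s n| <= e * n%:R ^+ 2) ->
  (fun n => expR ((2 / (n * n.+1)%:R) * (s n - ln 4 * (n * n.-1)%:R / 2)))
    @ \oo --> (4^-1 : R).
Proof.
move=> sE; have -> : 4^-1 = expR (- ln 4) :> R by rewrite expRN lnK // posrE.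
pose f n : R := 2 / (n * n.+1)%:R * (s n - ln 4 * (n * n.-1)%:R / 2).
suff fc : f @ \oo --> - ln 4.
  exact: (continuous_cvg _ (@continuous_expR R (- ln 4)) fc).
rewrite /f; apply/cvgrPdist_le => e e0; near=> n.
have n1 : 1 <= n%:R :> R by near: n; exact: near_ge_nat.
have n0 : 0 < n%:R :> R by rewrite (lt_le_trans _ n1).
have c0 : 0 <= ln 4 :> R by apply: ln_ge0; rewrite ler1n.
have sn : `|s n| <= e / 4 * n%:R ^+ 2.
  by near: n; apply: sE; rewrite divr_gt0.
have nb : 4 * ln 4 <= e * n%:R.
  by rewrite -ler_pdivrMl //; near: n; exact: near_ge_nat.
have [k nk] : exists k, n = k.+1 by exists n.-1; rewrite prednK // -(ltr0n R).
have kE : (n.-1)%:R = n%:R - 1 :> R by rewrite nk /= -natr1 addrK.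
rewrite !natrM kE -(natr1 n); set x : R := n%:R in n1 n0 sn nb *.
have -> : - ln 4 - 2 / (x * (x + 1)) * (s n - ln 4 * (x * (x - 1)) / 2)
   = - (2 * ln 4 / (x + 1) + 2 * s n / (x * (x + 1))).
  by field; apply/andP; split; rewrite gt_eqF // addr_gt0.
rewrite normrN; apply: le_trans (ler_normD _ _) _.
have x1 : 0 < x + 1 by rewrite addr_gt0.
have A : `|2 * ln 4 / (x + 1)| <= e / 2.
  rewrite ger0_norm ?divr_ge0 ?mulr_ge0 ?(ltW x1) // ler_pdivrMr //; nra.
have B : `|2 * s n / (x * (x + 1))| <= e / 2.
  rewrite normrM normfV (gtr0_norm (mulr_gt0 n0 x1)) ler_pdivrMr ?mulr_gt0 //.
  rewrite normrM ger0_norm //; nra.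
lra.
Unshelve. all: by end_near. Qed.

End Asymptotics.

(** * Logarithmic growth of the node polynomials *)

Section CapacityOfLejaNodes.
Variables (R : realType) (t : nat -> R).
Hypothesis t_leja : fast_leja_sequence t.
Hypothesis t_star : sequence_property_star t.

Let tinj := fast_leja_injective t_leja.
Let tI := fast_leja_bounds t_leja.
Notation p n := (node_prod t n).

(** Normalized by the capacity 1/4: it neither grows nor decreases exponentially
    exactly when the n-th root of the maximum tends to the capacity. *)
Definition scaled_max n : R := 4 ^+ n * `|p n (t n)|.

Lemma scaled_max_gt0 n : 0 < scaled_max n.
Proof.
rewrite mulr_gt0 ?exprn_gt0 // normr_gt0 /node_prod.
by apply/prodf_neq0 => i _; rewrite subr_eq0; apply/eqP => /tinj E;
  have := ltn_ord i; rewrite -E ltnn.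
Qed.

Lemma node_prod_near_max (e : R) : 0 < e -> \forall n \near \oo,
  forall x, 0 <= x <= 1 -> `|p n x| <= expR (e * n%:R) * `|p n (t n)|.
Proof.
move=> e0; near=> n => x x01.
have n2 : (2 <= n)%N by near: n; exists 2%N.
apply: le_trans (fast_leja_near_max t_leja n2 x01) _.
rewrite ler_wpM2r // ler_expR mulrC ler_wpM2r //.
have : `|max_ratio (sorted_array t n)| <= e.
  by near: n; move/cvgr0Pnorm_le : t_star; apply.
exact: le_trans (ler_norm _).
Unshelve. all: by end_near. Qed.

(** Near-maximality of t_n bounds the sup norm of the monic polynomial p_n, which
    cannot be much smaller than 4^-n. *)
Lemma ln_scaled_max_lower (e : R) : 0 < e ->
  \forall n \near \oo, - (e * n%:R) <= ln (scaled_max n).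
Proof.
move=> e0; near=> n.
have mx : forall x, 0 <= x <= 1 -> `|p n x| <= expR (e / 2 * n%:R) * `|p n (t n)|.
  by near: n; apply: node_prod_near_max; rewrite divr_gt0.
pose P : {poly R[i]} := \prod_(i < n) ('X - (t i)%:C%:P).
have mP : P \is monic by apply: monic_prod => i _; exact: monicXsubC.
have sP : size P = n.+1.
  rewrite /P -(big_mkord xpredT (fun i => 'X - (t i)%:C%:P)).
  rewrite -(big_map (fun i => (t i)%:C) xpredT (fun y => 'X - y%:P)).
  by rewrite size_prod_XsubC size_map size_iota subn0.
have h : (4 ^+ n)^-1 <= 2 * (expR (e / 2 * n%:R) * `|p n (t n)|).
  apply: (monic_sup_lower_bound mP sP) => x x01.
  rewrite horner_prod (eq_bigr (fun i : 'I_n => (x - t i)%:C)); last first.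
    by move=> i _; rewrite hornerXsubC rmorphB.
  by rewrite -rmorph_prod cabs_real mx.
have : 1 <= 2 * expR (e / 2 * n%:R) * scaled_max n.
  rewrite /scaled_max; have q0 : 0 < (4 : R) ^+ n by rewrite exprn_gt0.
  move: h; rewrite -(ler_pM2l q0) divff ?gt_eqF // => /le_trans; apply.
  by rewrite le_eqVlt; apply/orP; left; apply/eqP; ring.
have v0 := scaled_max_gt0 n; have x0 := expR_gt0 (e / 2 * n%:R).
have x20 : 0 < 2 * expR (e / 2 * n%:R) by rewrite mulr_gt0.
have lnE : ln (2 * expR (e / 2 * n%:R) * scaled_max n) =
    ln 2 + e / 2 * n%:R + ln (scaled_max n).
  by rewrite lnM ?posrE // lnM ?posrE // expRK.
rewrite -ler_ln ?posrE ?(mulr_gt0 x20) // ln1 lnE.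
have : ln 2 <= e / 2 * n%:R.
  by rewrite -ler_pdivrMl ?divr_gt0 //; near: n; exact: near_ge_nat.
lra.
Unshelve. all: by end_near. Qed.

Lemma ln_scaled_max_lower_all (e : R) : 0 < e -> exists2 D : R, 0 <= D &
  forall n, - (e * n%:R) - D <= ln (scaled_max n).
Proof.
move=> /[dup] e0 /ln_scaled_max_lower [N _ hN].
exists (\sum_(k < N) `|ln (scaled_max k)|); first by apply: sumr_ge0.
move=> n; have D0 : 0 <= \sum_(k < N) `|ln (scaled_max k)| by apply: sumr_ge0.
have [nN|Nn] := ltnP n N; last by have := hN n Nn => /=; lra.
apply: le_trans (_ : - `|ln (scaled_max n)| <= _); last first.
  by rewrite lerNl ler_normr lexx orbT.
rewrite (bigD1 (Ordinal nN)) //=.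
have : 0 <= \sum_(i < N | i != Ordinal nN) `|ln (scaled_max i)| by apply: sumr_ge0.
have : 0 <= e * n%:R by rewrite mulr_ge0 // ltW.
lra.
Qed.

Definition sum_ln n : R := \sum_(k < n) ln (scaled_max k).

(** The Vandermonde product is grouped by the larger index: the factors with
    larger index k are those of p_k (t_k). *)
Lemma VDM_prod n : normc (VDM (fun j : 'I_n => (t j)%:C)) * \prod_(k < n) 4 ^+ k
  = \prod_(k < n) scaled_max k.
Proof.
rewrite /VDM det_Vandermonde /scaled_max big_split /= mulrC; congr (_ * _).
rewrite cabs_prod (eq_bigr (fun i : 'I_n => \prod_(j < n | (i < j)%N) `|t j - t i|)).
  rewrite (exchange_big_dep xpredT) //=; apply: eq_bigr => j _.
  rewrite /node_prod normr_prod (big_ord_widen_cond n xpredT (fun i => `|t j - t i|)) //.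
  exact: ltnW.
move=> i _; rewrite cabs_prod; apply: eq_bigr => j _.
by rewrite !mxE -rmorphB cabs_real.
Qed.

Lemma sum_ln_upper n : sum_ln n <= 2 * ln (n`!%:R : R).
Proof.
have f0 : 0 < n`!%:R :> R by rewrite ltr0n fact_gt0.
have s0 : 0 < \prod_(k < n) scaled_max k.
  by apply: prodr_gt0 => i _; exact: scaled_max_gt0.
have -> : sum_ln n = ln (\prod_(k < n) scaled_max k).
  rewrite -[LHS]expRK /sum_ln expR_sum; congr ln.
  by apply: eq_bigr => i _; rewrite lnK // posrE scaled_max_gt0.
rewrite mulr_natl -lnXn // ler_ln ?posrE ?exprn_gt0 //.
rewrite -VDM_prod; apply: VDM_upper_bound => i; by exists (t i).
Qed.

Lemma sum_ln_lower (e : R) : 0 < e -> exists2 D : R, 0 <= D &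
  forall n, - (e * n%:R ^+ 2) - D * n%:R <= sum_ln n.
Proof.
move=> /[dup] e0 /ln_scaled_max_lower_all [D D0 hD]; exists D => // n.
apply: le_trans (_ : \sum_(k < n) (- (e * n%:R) - D) <= _).
  by rewrite sumr_const card_ord -[leRHS]mulr_natr expr2; lra.
apply: ler_sum => k _; apply: le_trans (hD k).
by rewrite lerD2r lerN2 ler_pM2l // ler_nat ltnW.
Qed.

End CapacityOfLejaNodes.
(** * The transfinite diameter of the unit interval *)

Section TransfiniteDiameterOfInterval.
Variables (R : realType) (t : nat -> R).
Hypothesis t_leja : fast_leja_sequence t.
Hypothesis t_star : sequence_property_star t.

(** The lower bound comes from the sup norms of monic polynomials, the upper one
    from the bound of Vandermonde determinants. *)
Lemma sum_ln_small (e : R) : 0 < e ->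
  \forall n \near \oo, `|sum_ln t n| <= e * n%:R ^+ 2.
Proof.
move=> e0; have e2 : 0 < e / 2 by rewrite divr_gt0.
have [D D0 hD] := sum_ln_lower t_leja t_star e2.
near=> n; rewrite ler_norml; apply/andP; split; last first.
  apply: le_trans (sum_ln_upper t_leja n) _.
  by near: n; exact: ln_factorial_small.
apply: le_trans (hD n); have n0 : 0 <= n%:R :> R by [].
have : D <= e / 2 * n%:R.
  by rewrite -ler_pdivrMl //; near: n; exact: near_ge_nat.
by rewrite expr2; nra.
Unshelve. all: by end_near. Qed.

Lemma prod_exp4 n :
  \prod_(k < n) 4 ^+ k = expR (ln 4 * (n * n.-1)%:R / 2) :> R.
Proof.
elim: n => [|n IH]; first by rewrite big_ord0 mul0n mulr0 mul0r expR0.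
rewrite big_ord_recr /= IH -{2}(@lnK R 4) ?posrE // -expRM_natl -expRD.
congr expR; rewrite !natrM -natr1; case: n {IH} => [|n]; first by rewrite !mul0r; ring.
by rewrite [n.+1.-1]/= -!natr1; field.
Qed.

Lemma VDM_rootE n : VDM_root (fun j : 'I_n => (t j)%:C) =
  expR ((2 / (n * n.+1)%:R) * (sum_ln t n - ln 4 * (n * n.-1)%:R / 2)).
Proof.
rewrite /VDM_root [X in expR X]mulrC expRM; congr (_ `^ _).
rewrite expRD expRN -prod_exp4.
have -> : expR (sum_ln t n) = \prod_(k < n) scaled_max t k.
  by rewrite expR_sum; apply: eq_bigr => i _; rewrite lnK // posrE scaled_max_gt0.
rewrite -VDM_prod mulfK // gt_eqF //.
by apply: prodr_gt0 => i _; rewrite exprn_gt0.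
Qed.

Lemma VDM_root_upper n (a : 'I_n -> R[i]) :
  (forall i, unit_interval R (a i)) ->
  VDM_root a <= expR ((2 / (n * n.+1)%:R) *
    (2 * ln n`!%:R - ln 4 * (n * n.-1)%:R / 2)).
Proof.
move=> aI; rewrite /VDM_root [X in expR X]mulrC expRM.
apply: ge0_ler_powR; rewrite ?nnegrE ?cabs_ge0 ?expR_ge0 ?divr_ge0 //.
rewrite expRD expRN -prod_exp4 ler_pdivlMr; last first.
  by apply: prodr_gt0 => i _; rewrite exprn_gt0.
have -> : expR (2 * ln n`!%:R) = n`!%:R ^+ 2 :> R.
  by rewrite expRM_natl lnK // posrE ltr0n fact_gt0.
apply: VDM_upper_bound => i; have [x] := aI i.
by rewrite /= in_itv /= => x01 <-; exists x.
Qed.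

Lemma VDM_root_cvg_quarter :
  (fun n => VDM_root (fun j : 'I_n => (t j)%:C)) @ \oo --> (4^-1 : R).
Proof.
under eq_fun => n do rewrite VDM_rootE.
apply: (quarter_root_cvg (s := sum_ln t)); exact: sum_ln_small.
Qed.

(** The Leja points bound diameter_n from below, VDM_upper_bound from above, and
    both bounds tend to 1/4. *)
Lemma diameter_n_cvg_quarter :
  diameter_n (unit_interval R) @ \oo --> (4^-1 : R).
Proof.
have up := quarter_root_cvg (s := fun n => 2 * ln (n`!%:R : R)).
apply: squeeze_cvgr VDM_root_cvg_quarter (up _); last first.
  move=> e e0; have := ln_factorial_small e0; apply: filterS => n.
  by rewrite ger0_norm // mulr_ge0 // ln_ge0 // ler1n fact_gt0.
apply: nearW => n; rewrite /diameter_n.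
set E := [set _ | _ in _].
have ubE : ubound E (expR ((2 / (n * n.+1)%:R) *
    (2 * ln n`!%:R - ln 4 * (n * n.-1)%:R / 2))).
  by move=> _ [a aI <-]; exact: VDM_root_upper.
have Et : E (VDM_root (fun j : 'I_n => (t j)%:C)).
  exists (fun j : 'I_n => (t j)%:C) => // i.
  by exists (t i) => //; rewrite /= in_itv /= fast_leja_bounds.
apply/andP; split; first by apply: ub_le_sup => //; eexists; exact: ubE.
by apply: ge_sup => //; eexists; exact: Et.
Qed.

Lemma transfinite_diameterE : transfinite_diameter (unit_interval R) = 4^-1.
Proof. exact/cvg_lim/diameter_n_cvg_quarter. Qed.

End TransfiniteDiameterOfInterval.

(** * Sup norms of the node polynomials *)

Lemma last_block N q n : (2 <= q)%N -> (2 * N <= n)%N -> (2 * q <= n)%N ->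
  exists m, [/\ (m <= n)%N, (m * q <= n)%N, (n <= 2 * q * m)%N & (N <= n - m)%N].
Proof.
move=> q2 N2 qn; exists (n %/ q)%N; set m := (n %/ q)%N.
have mq : (m * q <= n)%N by exact: leq_trunc_div.
have mq1 : (n < m.+1 * q)%N by apply: ltn_ceil; lia.
have m1 : (0 < m)%N by rewrite divn_gt0; lia.
split=> //; try nia.
Qed.

Section SupNormOfNodePolynomials.
Variables (R : realType) (t : nat -> R).
Hypothesis t_leja : fast_leja_sequence t.
Hypothesis t_star : sequence_property_star t.
Notation p n := (node_prod t n).

(** All the factors |x - t_i| are at most 1 on [0, 1]. *)
Lemma node_prod_decreasing n m x : (n <= m)%N -> 0 <= x <= 1 ->
  `|p m x| <= `|p n x|.
Proof.
move=> nm /andP[x0 x1]; rewrite -(subnKC nm) /node_prod big_split_ord normrM.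
rewrite ler_piMr // normr_prod; apply: prodr_ile1 => i _.
rewrite normr_ge0 ler_norml /=.
have /andP[] := fast_leja_bounds t_leja (n + i); lra.
Qed.

Lemma ln_scaled_max_diff (e : R) : 0 < e -> exists N, forall k n,
  (N <= k <= n)%N ->
  ln (scaled_max t n) <= ln (scaled_max t k) + (n - k)%:R * ln 4 + e * k%:R.
Proof.
move=> /(node_prod_near_max t_leja t_star) [N _ hN]; exists N => k n /andP[Nk kn].
have v0 m := scaled_max_gt0 t_leja m.
have le1 : `|p n (t n)| <= expR (e * k%:R) * `|p k (t k)|.
  have tn := fast_leja_bounds t_leja n.
  by apply: le_trans (node_prod_decreasing kn tn) _; exact: (hN k Nk).
have : scaled_max t n <= 4 ^+ (n - k) * expR (e * k%:R) * scaled_max t k.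
  rewrite /scaled_max -{1}(subnK kn) exprD.
  have q0 m : 0 < (4 : R) ^+ m by rewrite exprn_gt0.
  rewrite (_ : _ * _ * (_ * _) =
      4 ^+ (n - k) * 4 ^+ k * (expR (e * k%:R) * `|p k (t k)|)).
    by rewrite ler_pM2l // mulr_gt0.
  by ring.
have x0 := expR_gt0 (e * k%:R).
have q0 : 0 < (4 : R) ^+ (n - k) by rewrite exprn_gt0.
have qx0 : 0 < 4 ^+ (n - k) * expR (e * k%:R) by rewrite mulr_gt0.
rewrite -ler_ln ?posrE ?(mulr_gt0 qx0) // lnM ?posrE // lnM ?posrE // expRK.
by rewrite lnXn // -mulr_natl; lra.
Qed.

(** If ln v_n > e n, then by ln_scaled_max_diff all the ln v_k with k in a block of
    length about n / q before n are at least e n / 2, where q is a constant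
    about 4 ln 4 / e. The sum of the ln v_k would be of order n^2, against
    sum_ln_small. *)
Lemma ln_scaled_max_upper (e : R) : 0 < e ->
  \forall n \near \oo, ln (scaled_max t n) <= e * n%:R.
Proof.
move=> e0; have c0 : 0 < ln 4 :> R by rewrite ln_gt0 // ltr1n.
(* With 4 ln 4 <= e q, moving n / q indices down costs at most e n / 4. *)
have [q q2 qE] : exists2 q, (2 <= q)%N & 4 * ln 4 <= e * q%:R.
  have [N _ hN] := near_ge_nat (e^-1 * (4 * ln 4)).
  exists (maxn 2 N); first exact: leq_maxl.
  by rewrite -ler_pdivrMl //; apply: (hN (maxn 2 N)); exact: leq_maxr.
have q0 : 0 < q%:R :> R by rewrite ltr0n; lia.
have e4 : 0 < e / 4 by rewrite divr_gt0.
pose a := e / 32 / q%:R; have e1 : 0 < a by rewrite !divr_gt0.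
have [N hN] := ln_scaled_max_diff e4.
have [D D0 hD] := sum_ln_lower t_leja t_star e1.
near=> n; rewrite leNgt; apply/negP => vn.
have nq1 : (2 * q <= n)%N by near: n; exists (2 * q)%N.
have nN2 : (2 * N <= n)%N by near: n; exists (2 * N)%N.
have sn : `|sum_ln t n| <= a * n%:R ^+ 2.
  by near: n; exact: sum_ln_small.
have nD : D <= a * n%:R.
  by rewrite -ler_pdivrMl //; near: n; exact: near_ge_nat.
have [m [mn mq nq2 Nm]] := last_block q2 nN2 nq1.
have big k : (n - m <= k < n)%N -> e / 2 * n%:R <= ln (scaled_max t k).
  move=> /andP[mk kn].
  have Nk : (N <= k)%N by exact: leq_trans mk.
  have := hN k n; rewrite Nk ltnW // => /(_ isT).
  have kn' : k%:R <= n%:R :> R by rewrite ler_nat ltnW.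
  have nk : (n - k)%:R * q%:R <= n%:R :> R.
    rewrite -natrM ler_nat (leq_trans _ mq) // leq_mul2r.
    by rewrite leq_subLR addnC -leq_subLR mk orbT.
  have : (n - k)%:R * ln 4 <= e / 4 * n%:R.
    rewrite -(ler_pM2r q0); have n0 : 0 <= n%:R :> R by [].
    have := ler_wpM2r (ltW c0) nk; have := ler_wpM2l n0 qE; lra.
  have : e / 4 * k%:R <= e / 4 * n%:R by rewrite ler_pM2l.
  lra.
have sumE : sum_ln t n = sum_ln t (n - m) +
    \sum_(i < m) ln (scaled_max t (n - m + i)).
  have sumD j l : sum_ln t (j + l) = sum_ln t j +
      \sum_(i < l) ln (scaled_max t (j + i)) by rewrite /sum_ln big_split_ord.
  by rewrite -sumD subnK.
have sb : m%:R * (e / 2 * n%:R) <= \sum_(i < m) ln (scaled_max t (n - m + i)).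
  rewrite -[leLHS](_ : \sum_(i < m) (e / 2 * n%:R) = _); last first.
    by rewrite sumr_const card_ord mulr_natl.
  apply: ler_sum => i _; apply: big.
  by rewrite leq_addr -[X in (_ < X)%N](subnK mn) ltn_add2l ltn_ord.
have nq : n%:R <= 2 * q%:R * m%:R :> R.
  by rewrite -!natrM ler_nat.
have := hD (n - m)%N; move: sn sumE sb; rewrite ler_norml => /andP[_ sn] sumE sb.
have nm : (n - m)%:R <= n%:R :> R by rewrite ler_nat leq_subr.
have nm0 : 0 <= (n - m)%:R :> R by [].
have n0 : 0 < n%:R :> R.
  by rewrite ltr0n (leq_trans _ nq1) // muln_gt0 (ltnW q2).
have sq : (n - m)%:R ^+ 2 <= n%:R ^+ 2 :> R by rewrite ler_sqr ?nnegrE.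
have aq : a * q%:R = e / 32 by rewrite /a divfK // gt_eqF.
have A1 : a * (n - m)%:R ^+ 2 <= a * n%:R ^+ 2 by rewrite ler_pM2l.
have A2 : D * (n - m)%:R <= a * n%:R ^+ 2 by rewrite expr2 mulrA; apply: ler_pM.
have A3 : 8 * (a * n%:R ^+ 2) <= m%:R * (e / 2 * n%:R).
  have -> : e / 2 = 16 * (a * q%:R) by rewrite aq; field.
  have : 8 * a * n%:R * n%:R <= 8 * a * n%:R * (2 * q%:R * m%:R).
    by rewrite ler_pM2l // (mulr_gt0 _ n0) // (mulr_gt0 _ e1).
  by rewrite expr2; lra.
have A4 : 0 < a * n%:R ^+ 2 by rewrite mulr_gt0 // exprn_gt0.
lra.
Unshelve. all: by end_near. Qed.

Lemma node_prod_subexponential (e : R) : 0 < e -> \forall n \near \oo,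
  forall x, 0 <= x <= 1 -> 4 ^+ n * `|p n x| <= expR (e * n%:R).
Proof.
move=> e0; have e2 : 0 < e / 2 by rewrite divr_gt0.
near=> n => x x01.
have h1 : `|p n x| <= expR (e / 2 * n%:R) * `|p n (t n)|.
  by move: x x01; near: n; exact: node_prod_near_max.
have h2 : ln (scaled_max t n) <= e / 2 * n%:R.
  by near: n; exact: ln_scaled_max_upper.
have q0 : 0 < (4 : R) ^+ n by rewrite exprn_gt0.
apply: le_trans (_ : expR (e / 2 * n%:R) * scaled_max t n <= _).
  by rewrite mulrCA ler_pM2l.
have -> : e * n%:R = e / 2 * n%:R + e / 2 * n%:R by field.
rewrite expRD ler_pM2l ?expR_gt0 //.
by rewrite -ler_expR lnK ?posrE ?scaled_max_gt0 // in h2.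
Unshelve. all: by end_near. Qed.

End SupNormOfNodePolynomials.

(** * Asymptotic distribution of the nodes *)

Section PowerSums.
Variables (R : realType) (t : nat -> R).
Hypothesis t_leja : fast_leja_sequence t.
Hypothesis t_star : sequence_property_star t.
Notation ys n := (node_charts t n).

(** With c = z - 2 z^2, e^c <= 1 / (1 - c), and
    (1 + z) (1 - z + 2 z^2) = 1 + z^2 (1 + 2 z) >= 1. *)
Lemma expR_le_1Dx (z : R) : - 2^-1 <= z -> expR (z - 2 * z ^+ 2) <= 1 + z.
Proof.
move=> z2; have q0 : 0 < 1 - z + 2 * z ^+ 2.
  have -> : 1 - z + 2 * z ^+ 2 = 2 * (z - 4^-1) ^+ 2 + 7 / 8 by field.
  by rewrite ltr_wpDl // mulr_ge0 // sqr_ge0.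
have e1 := expR_ge1Dx (- (z - 2 * z ^+ 2)); have x0 := expR_gt0 (z - 2 * z ^+ 2).
rewrite -(ler_pM2l q0); apply: (@le_trans _ _ 1).
  rewrite -[leRHS](expRxMexpNx_1 (z - 2 * z ^+ 2)) mulrC ler_pM2l //.
  by apply: le_trans e1; lra.
rewrite (_ : (1 - z + 2 * z ^+ 2) * (1 + z) = 1 + z ^+ 2 * (1 + 2 * z)); last by ring.
by rewrite lerDl mulr_ge0 ?sqr_ge0 //; lra.
Qed.

Lemma sum_geometric_le (r : R) l : 0 <= r < 1 -> \sum_(i < l) r ^+ i <= (1 - r)^-1.
Proof.
move=> /andP[r0 r1]; have d0 : 0 < 1 - r by rewrite subr_gt0.
rewrite -(ler_pM2l d0) divff ?gt_eqF //.
have := subrX1 r l; have := exprn_ge0 l r0; lra.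
Qed.

(** At w on the unit circle, with w + 1/w = chart x, the k-th factor is
    w (chart x - chart (t k)): the modulus of Q n is that of 4^n p_n (x). *)
Let Q n : {poly R[i]} := \prod_(k < n) (1 - (chart (t k))%:C *: 'X + 'X^2).

Let QE n w : (Q n).[w] = \prod_(k < n) (1 - (chart (t k))%:C * w + w ^+ 2).
Proof.
rewrite horner_prod; apply: eq_bigr => k _.
by rewrite !hornerD hornerN hornerZ hornerX hornerXn hornerC.
Qed.

(** The coefficients of Q n are at most M; inside the disc of radius 1/2 the
    polynomial is at most 2 M. *)
Lemma reversed_node_poly_bound n M : (forall x, 0 <= x <= 1 ->
    4 ^+ n * `|node_prod t n x| <= M) ->
  forall w, normc w <= 2^-1 -> normc (Q n).[w] <= 2 * M.
Proof.
move=> nM w w2; have QM j : normc (Q n)`_j <= M.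
  apply: coef_unit_circle => z z1; have [x [x01 xz]] := unit_circle_interval z1.
  have z0 : z != 0 by rewrite -cabs_eq0 z1 oner_eq0.
  apply: le_trans (nM _ x01); rewrite QE cabs_prod /node_prod normr_prod.
  have -> : (4 : R) ^+ n = \prod_(i < n) 4 by rewrite prodr_const card_ord.
  rewrite -big_split; apply: ler_prod => k _; rewrite cabs_ge0 /=.
  have -> : 1 - (chart (t k))%:C * z + z ^+ 2 = z * (4 * (x - t k))%:C.
    have -> : (4 * (x - t k))%:C = chart x%:C - (chart (t k))%:C.
      by rewrite -(rmorph_chart (real_complex R)) -rmorphB /chart; congr _%:C; ring.
    by rewrite xz mulrBr mulrDr divff //; ring.
  by rewrite cabsM z1 mul1r cabs_real normrM normr_nat.
have M0 : 0 <= M by apply: le_trans (QM 0%N); exact: cabs_ge0.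
rewrite horner_coef; apply: le_trans (cabs_sum _ _ _) _.
apply: le_trans (_ : \sum_(i < size (Q n)) M * 2^-1 ^+ i <= _).
  apply: ler_sum => i _; rewrite cabsM cabsX ler_pM ?cabs_ge0 ?exprn_ge0 ?cabs_ge0 //.
  by rewrite lerXn2r ?nnegrE ?cabs_ge0.
rewrite -mulr_sumr mulrC ler_wpM2r //.
apply: le_trans (sum_geometric_le _ _) _; first by apply/andP; split; lra.
by rewrite (_ : 1 - 2^-1 = 2^-1) ?invrK //; field.
Qed.

(** The product of the values of Q n at the m points z w, with z^m = 1, is obtained
    factor by factor: it replaces each u by u^m and w by w^m. *)
Lemma prod_chebV_bound n M m w : (0 < m)%N -> (forall x, 0 <= x <= 1 ->
    4 ^+ n * `|node_prod t n x| <= M) -> normc w <= 2^-1 ->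
  normc (\prod_(k < n) (1 - (chebV (chart (t k)) m)%:C * w ^+ m + (w ^+ m) ^+ 2))
  <= (2 * M) ^+ m.
Proof.
move=> m0 nM w2; have [z zm] := prim_root_complex R m0.
have z1 := prim_root_cabs m0 zm.
have -> : \prod_(k < n) (1 - (chebV (chart (t k)) m)%:C * w ^+ m + (w ^+ m) ^+ 2)
    = \prod_(i < m) (Q n).[z ^+ i * w].
  under [RHS]eq_bigr => i _ do rewrite QE.
  rewrite exchange_big /=; apply: eq_bigr => k _.
  have [u [v [yE uv u1 v1]]] := unit_circle_lift (chart_bound (fast_leja_bounds t_leja k)).
  rewrite (rmorph_chebV (real_complex R)) (chebV_unit _ yE uv) yE.
  transitivity ((1 - (w * u) ^+ m) * (1 - (w * v) ^+ m)).
    rewrite !exprMn; have uvm : u ^+ m * v ^+ m = 1 by rewrite -exprMn uv expr1n.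
    have -> : (w ^+ m) ^+ 2 = u ^+ m * v ^+ m * (w ^+ m) ^+ 2 by rewrite uvm mul1r.
    by ring.
  rewrite -!(prod_prim_root_factor _ m0 zm) -big_split; apply: eq_bigr => i _ /=.
  have -> : (z ^+ i * w) ^+ 2 = u * v * (z ^+ i * w) ^+ 2 by rewrite uv mul1r.
  by ring.
have -> : (2 * M) ^+ m = \prod_(i < m) (2 * M) by rewrite prodr_const card_ord.
rewrite cabs_prod.
apply: ler_prod => i _; rewrite cabs_ge0 reversed_node_poly_bound //.
by rewrite cabsM cabsX z1 expr1n mul1r.
Qed.

Lemma power_sum_nodes n m :
  power_sum (ys n) m = \sum_(k < n) chebV (chart (t k)) m.
Proof. by rewrite /power_sum big_map -{1}(subn0 n) -/(index_iota 0 n) big_mkord. Qed.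

(** Take logarithms in prod_chebV_bound when w^m is the real number sg r^m: the
    left-hand side is - sg r^m times the power sum, up to a term n r^(2m). *)
Lemma power_sum_one_side n M m r w (sg : R) : (0 < m)%N -> 0 < M ->
  (forall x, 0 <= x <= 1 -> 4 ^+ n * `|node_prod t n x| <= M) ->
  0 < r <= 6^-1 -> `|sg| = 1 -> normc w = r -> w ^+ m = (sg * r ^+ m)%:C ->
  - (sg * r ^+ m * power_sum (ys n) m) - 18 * (r ^+ m) ^+ 2 * n%:R
  <= m%:R * ln (2 * M).
Proof.
move=> m0 M0 nM /andP[r0 r5] sg1 wr wm; set s := r ^+ m.
have r1 : r <= 1 by lra.
have s0 : 0 < s by rewrite exprn_gt0.
have s5 : s <= 6^-1.
  apply: le_trans r5; rewrite /s -(prednK m0) exprS ler_piMr ?(ltW r0) //.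
  by rewrite exprn_ile1 ?(ltW r0) // r1.
pose a k := - (sg * s * chebV (chart (t k)) m).
pose z k := a k + s ^+ 2.
have ab k : `|a k| <= 2 * s.
  rewrite normrN !normrM sg1 mul1r (gtr0_norm s0) mulrC ler_pM2r //.
  by rewrite chebV_bound // chart_bound // fast_leja_bounds.
have zb k : `|z k| <= 3 * s.
  apply: le_trans (ler_normD _ _) _; rewrite (ger0_norm (sqr_ge0 s)).
  have := ab k; nra.
have z1 k : - 2^-1 <= z k.
  have := zb k; rewrite ler_norml => /andP[h _]; lra.
have zz k : a k - 18 * s ^+ 2 <= z k - 2 * z k ^+ 2.
  have : z k ^+ 2 <= (3 * s) ^+ 2.
    by rewrite -(real_normK (num_real (z k))) lerXn2r ?nnegrE // mulr_ge0 // ltW.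
  have := sqr_ge0 s; rewrite /z; nra.
have w2 : normc w <= 2^-1 by rewrite wr; lra.
have := prod_chebV_bound m0 nM w2.
rewrite (eq_bigr (fun k : 'I_n => (1 + z k)%:C)); last first.
  move=> k _; rewrite wm -rmorphXn -rmorphM -rmorphN -[1]/(1%:C) -!rmorphD.
  congr _%:C; rewrite exprMn -(real_normK (num_real sg)) sg1 expr1n mul1r.
  by rewrite -/s /z /a; ring.
rewrite -rmorph_prod cabs_real => hM.
have P0 k : 0 < 1 + z k by have := z1 k; lra.
have {}hM : expR (\sum_(k < n) (z k - 2 * z k ^+ 2)) <= (2 * M) ^+ m.
  apply: le_trans hM; apply: le_trans (ler_norm _).
  by rewrite expR_sum; apply: ler_prod => k _; rewrite expR_ge0 expR_le_1Dx.
have M2 : 0 < 2 * M by rewrite mulr_gt0.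
have {}hM : \sum_(k < n) (z k - 2 * z k ^+ 2) <= m%:R * ln (2 * M).
  by rewrite mulr_natl -lnXn // -ler_expR lnK // posrE exprn_gt0.
apply: le_trans hM; rewrite power_sum_nodes.
apply: le_trans (_ : \sum_(k < n) (a k - 18 * s ^+ 2) <= _); last exact: ler_sum.
rewrite sumrB sumr_const card_ord sumrN -mulr_sumr -[_ *+ n]mulr_natr.
by rewrite -/s; lra.
Qed.

(** This is the convergence of the nodes to the equilibrium distribution, tested
    against Chebyshev polynomials. Jensen's inequality for Q n, in the discrete
    form of power_sum_one_side, is used for both signs sg. *)
Lemma power_sum_small m (e : R) : (0 < m)%N -> 0 < e ->
  \forall n \near \oo, `|power_sum (ys n) m| <= e * n%:R.
Proof.
move=> m0 e0; pose r := Num.min 6^-1 (e / 36).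
have r0 : 0 < r by rewrite lt_min divr_gt0 // invr_gt0 ltr0n.
have r5 : r <= 6^-1 by rewrite ge_min lexx.
have re : 36 * r <= e by rewrite mulrC -ler_pdivlMr // ge_min lexx orbT.
have r1 : r <= 1 by lra.
pose s := r ^+ m; have s0 : 0 < s by rewrite exprn_gt0.
have sr : s <= r.
  rewrite /s -(prednK m0) exprS ler_piMr ?(ltW r0) //.
  by rewrite exprn_ile1 ?(ltW r0) // r1.
have m0' : 0 < m%:R :> R by rewrite ltr0n.
(* The rate d of Q n makes m d n a quarter of e s n. *)
pose d := e * s / (4 * m%:R); have d0 : 0 < d by rewrite divr_gt0 ?mulr_gt0.
have m20 : (0 < 2 * m)%N by rewrite muln_gt0.
have [zeta zP] := prim_root_complex R m20.
have z1 := prim_root_cabs m20 zP.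
(* A 2m-th root of unity provides the negative sign. *)
have zm : zeta ^+ m = -1.
  have : (zeta ^+ m) ^+ 2 == 1 by rewrite -exprM mulnC (prim_expr_order zP).
  rewrite sqrf_eq1 => /orP[|/eqP//].
  rewrite -(prim_order_dvd zP) => /dvdn_leq; rewrite m0 => /(_ isT); lia.
near=> n.
have nM x : 0 <= x <= 1 -> 4 ^+ n * `|node_prod t n x| <= expR (d * n%:R).
  by move: x; near: n; exact: node_prod_subexponential.
have nl : 4 * m%:R * ln 2 <= e * s * n%:R.
  by rewrite -ler_pdivrMl ?mulr_gt0 //; near: n; exact: near_ge_nat.
have n0 : 0 <= n%:R :> R by [].
have r05 : 0 < r <= 6^-1 by rewrite r0 r5.
have rC : normc r%:C = r by rewrite cabs_real gtr0_norm.
have rz : normc (r%:C * zeta) = r by rewrite cabsM z1 mulr1.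
have wp : r%:C ^+ m = (1 * r ^+ m)%:C by rewrite mul1r rmorphXn.
have wn : (r%:C * zeta) ^+ m = (-1 * r ^+ m)%:C.
  by rewrite exprMn zm mulrC rmorphM rmorphN1 rmorphXn.
have plus := power_sum_one_side m0 (expR_gt0 _) nM r05 (normr1 _) rC wp.
have minus := power_sum_one_side m0 (expR_gt0 _) nM r05 (normrN1 _) rz wn.
have lnE : ln (2 * expR (d * n%:R)) = ln 2 + d * n%:R.
  by rewrite lnM ?posrE ?expR_gt0 // expRK.
have md : m%:R * d = e * s / 4 by rewrite /d; field; rewrite gt_eqF.
have up : m%:R * (ln 2 + d * n%:R) <= s * (e / 2 * n%:R).
  by rewrite mulrDr mulrA md; lra.
have s18 : 18 * s ^+ 2 * n%:R <= s * (e / 2 * n%:R).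
  rewrite (_ : 18 * s ^+ 2 * n%:R = s * (18 * s * n%:R)); last by ring.
  by rewrite ler_pM2l // ler_wpM2r //; lra.
rewrite ler_norml -(ler_pM2l s0) -[X in _ && X](ler_pM2l s0).
rewrite lnE -/s in plus minus; apply/andP; split; lra.
Unshelve. all: by end_near. Qed.

End PowerSums.

(** * Subexponential interpolation error *)

Section InterpolationOfPolynomials.
Variables (R : realType) (t : nat -> R).
Hypothesis t_leja : fast_leja_sequence t.
Hypothesis t_star : sequence_property_star t.
Notation ys n := (node_charts t n).

Lemma power_sums_small (e : R) N : 0 < e -> \forall n \near \oo,
  forall m, (0 < m <= N)%N -> `|power_sum (ys n) m| <= e * n%:R.
Proof.
move=> e0; elim: N => [|N IH].
  by apply: nearW => n m /andP[m0 m1]; have := leq_trans m0 m1.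
near=> n => m /andP[m0]; rewrite leq_eqVlt => /orP[/eqP ->|mN].
  by near: n; exact: power_sum_small.
suff: forall m, (0 < m <= N)%N -> `|power_sum (ys n) m| <= e * n%:R.
  by apply; rewrite m0 -ltnS.
by near: n.
Unshelve. all: by end_near. Qed.

(** In Newton's identities with weights q^(2m), the finitely many power sums of
    small degree are o(n), the others are at most 2 n and their weights are small.
    Writing q^(2m) = q^m q^m leaves a convergent geometric series in both cases. *)
Lemma recip_subexponential (e : R) : 0 < e -> \forall n \near \oo,
  forall x l, 0 <= x <= 1 ->
    `|recip (chart x :: ys n) l| <= expR (e * (n + l)%:R).
Proof.
move=> e0; pose q : R := expR (- (e / 2)).
have q0 : 0 < q by exact: expR_gt0.
have q1 : q < 1 by rewrite -expR0 ltr_expR oppr_lt0 divr_gt0.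
have d0 : 0 < 1 - q by rewrite subr_gt0.
(* e1 n / (1 - q) is half of e n; the other half absorbs the term of x. *)
pose e1 := e * (1 - q) / 2; have e10 : 0 < e1 by rewrite divr_gt0 ?mulr_gt0.
have [N qN] : exists N, q ^+ N.+1 <= e1 / 2.
  have qabs : `|q| < 1 by rewrite ger0_norm ?ltW.
  have /cvgr0Pnorm_le/(_ (e1 / 2)) := cvg_geometric 1 qabs.
  case=> [|N _ hN]; first by rewrite divr_gt0.
  exists N; have := hN N.+1 (leqnSn N).
  by rewrite /geometric /= mul1r ger0_norm // exprn_ge0 // ltW.
near=> n => x l x01.
have n0 : 0 <= n%:R :> R by [].
have cb m : (0 < m <= N)%N -> `|power_sum (ys n) m| <= e1 * n%:R.
  move: m; near: n; exact: power_sums_small.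
pose c m := power_sum (chart x :: ys n) m.
have cE m : c m = chebV (chart x) m + power_sum (ys n) m by rewrite /c /power_sum big_cons.
have Vb m (y : R) : 0 <= y <= 1 -> `|chebV (chart y) m| <= 2.
  by move=> y01; apply: chebV_bound; exact: chart_bound.
have cb2 m : `|power_sum (ys n) m| <= 2 * n%:R.
  rewrite power_sum_nodes; apply: le_trans (ler_norm_sum _ _ _) _.
  apply: le_trans (_ : \sum_(k < n) 2 <= _); last by rewrite sumr_const card_ord mulr_natr.
  by apply: ler_sum => k _; apply: Vb; exact: fast_leja_bounds.
have cq m : (0 < m)%N -> `|c m| * (q ^+ 2) ^+ m <= (2 + e1 * n%:R) * q ^+ m.
  move=> m0; rewrite exprAC expr2 mulrA ler_pM2r ?exprn_gt0 //.
  have qm1 : q ^+ m <= 1 by rewrite exprn_ile1 ?ltW.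
  have qm0 : 0 <= q ^+ m by rewrite exprn_ge0 ?ltW.
  rewrite cE; apply: le_trans (ler_wpM2r qm0 (ler_normD _ _)) _; rewrite mulrDl.
  apply: lerD; first by rewrite -[leRHS]mulr1 ler_pM // Vb.
  have [mN|Nm] := leqP m N; first by rewrite -[leRHS]mulr1 ler_pM // cb // m0.
  apply: le_trans (_ : 2 * n%:R * (e1 / 2) <= _); last by lra.
  rewrite ler_pM //; apply: (le_trans _ qN).
  by rewrite ler_wiXn2l ?ltW.
have hB k : \sum_(i < k) `|c i.+1| * (q ^+ 2) ^+ i.+1 <= e * n%:R.
  apply: le_trans (_ : \sum_(i < k) (2 + e1 * n%:R) * q ^+ i <= _).
    apply: ler_sum => i _; apply: le_trans (cq i.+1 _) _ => //.
    rewrite ler_wpM2l //; first by rewrite addr_ge0 ?mulr_ge0 // ltW.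
    by rewrite ler_wiXn2l ?ltW.
  rewrite -mulr_sumr.
  apply: le_trans (_ : (2 + e1 * n%:R) * (1 - q)^-1 <= _).
    rewrite ler_wpM2l ?sum_geometric_le ?(ltW q0) ?q1 //.
    by rewrite addr_ge0 ?mulr_ge0 // ltW.
  rewrite ler_pdivrMr //.
  have : 4 <= e * (1 - q) * n%:R.
    by rewrite -ler_pdivrMl ?mulr_gt0 //; near: n; exact: near_ge_nat.
  rewrite /e1; lra.
have := @newton_bound R (recip (chart x :: ys n)) c (q ^+ 2) (e * n%:R) l
  (sqr_ge0 q) (recip0 _) (recip_newton _) hB.
have -> : (q ^+ 2) ^+ l = expR (- (e * l%:R)).
  rewrite -exprM mulnC exprM /q -expRM_natl -expRM_natl.
  by congr expR; field.
rewrite expRN ler_pdivrMr ?expR_gt0 // -expRD => /le_trans; apply.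
by rewrite natrD mulrDr.
Unshelve. all: by end_near. Qed.

(** Interpolation at n + 1 nodes may amplify a polynomial of degree K by an
    arbitrarily slow exponential in n + K only. The factor K + 1 of
    interpolation_error_bound is absorbed by the exponential. *)
Lemma interpolation_error_subexponential (e : R) : 0 < e ->
  exists C : R, 0 <= C /\ \forall n \near \oo,
  forall K (P : {poly R[i]}) (d x : R), (size P <= K.+1)%N ->
    (forall z : R, 0 <= z <= 1 -> normc P.[z%:C] <= d) -> 0 <= x <= 1 ->
    normc (P.[x%:C] -
      (interpolant (fun j => (t j)%:C) (fun z => P.[z]) n).[x%:C]) <=
    C * d * expR (e * (n + K)%:R).
Proof.
move=> e0; have e4 : 0 < e / 4 by rewrite divr_gt0.
exists (2 * (1 + 4 / e) * expR e); split.
  by rewrite !mulr_ge0 ?expR_ge0 // addr_ge0 // divr_ge0 // ltW.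
have [N1 _ h1] := node_prod_subexponential t_leja t_star e4.
have [N2 _ h2] := recip_subexponential e4.
exists (maxn N1 N2) => // n /= Nn K P d x szP Pd x01.
have n1 : (N1 <= n.+1)%N by rewrite ltnW // ltnS (leq_trans (leq_maxl _ _) Nn).
have n2 : (N2 <= n.+1)%N by rewrite ltnW // ltnS (leq_trans (leq_maxr _ _) Nn).
have d0 : 0 <= d by apply: le_trans (Pd _ x01); exact: cabs_ge0.
have := @interpolation_error_bound R t n K P x d (expR (e / 4 * n.+1%:R))
  (expR (e / 4 * (n.+1 + K)%:R)) (fast_leja_injective t_leja) szP x01 Pd
  (h1 _ n1 _ x01) _.
move=> /(_ _)/le_trans; apply.
  move=> l lK; apply: le_trans (h2 _ n2 x l x01) _.
  by rewrite ler_expR ler_pM2l // ler_nat leq_add2l.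
have K1 : K.+1%:R <= (1 + 4 / e) * expR (e / 4 * K%:R).
  have x1 := expR_ge1Dx (e / 4 * K%:R).
  have x2 : 1 <= expR (e / 4 * K%:R).
    by apply: le_trans x1; rewrite lerDl mulr_ge0 // ltW.
  have : K%:R <= 4 / e * expR (e / 4 * K%:R).
    have e4' : 0 < 4 / e by rewrite divr_gt0.
    have KE : K%:R = 4 / e * (e / 4 * K%:R) by field; rewrite gt_eqF.
    by rewrite [leLHS]KE ler_pM2l //; lra.
  by move=> h; rewrite -(natr1 K) mulrDl mul1r addrC lerD.
apply: le_trans (_ : (1 + 4 / e) * expR (e / 4 * K%:R) * (2 * d) *
  (expR (e / 4 * n.+1%:R) * expR (e / 4 * (n.+1 + K)%:R)) <= _).
  rewrite ler_pM2r ?(mulr_gt0 (expR_gt0 _) (expR_gt0 _)) //.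
  by apply: ler_wpM2r => //; exact: mulr_ge0.
rewrite (_ : _ * (2 * d) * _ = 2 * (1 + 4 / e) * d * (expR (e / 4 * K%:R) *
  (expR (e / 4 * n.+1%:R) * expR (e / 4 * (n.+1 + K)%:R)))); last by ring.
rewrite (_ : 2 * (1 + 4 / e) * expR e * d * _ = 2 * (1 + 4 / e) * d *
  (expR e * expR (e * (n + K)%:R))); last by ring.
rewrite ler_wpM2l //.
  by rewrite !mulr_ge0 // addr_ge0 // divr_ge0 // ltW.
rewrite -!expRD ler_expR !natrD -(natr1 n).
have : 0 <= e * n%:R by rewrite mulr_ge0 // ltW.
have : 0 <= e * K%:R by rewrite mulr_ge0 // ltW.
lra.
Qed.

End InterpolationOfPolynomials.

(** * Taylor polynomials of an analytic function *)

Section LocalApproximation.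
Variable R : realType.
Implicit Types (g : R -> R[i]) (f : R[i] -> R[i]) (B x z : R).

(** Geometric approximation near z with the fixed rate 1/2, together with a
    geometric bound on the whole interval. The same B plays all the parts so that
    the property is monotone in B. *)
Definition locally_approx g B z : Prop := exists P : nat -> {poly R[i]},
  forall d, [/\ (size (P d) <= d.+1)%N,
    forall x, `|x - z| < B^-1 -> normc (g x - (P d).[x%:C]) <= B * 2^-1 ^+ d &
    forall x, 0 <= x <= 1 -> normc (P d).[x%:C] <= B ^+ d.+1].

Lemma locally_approx_mono g B B' z : 0 < B -> B <= B' ->
  locally_approx g B z -> locally_approx g B' z.
Proof.
move=> B0 BB [P hP]; have B'0 : 0 < B' by rewrite (lt_le_trans B0).
exists P => d; have [s e u] := hP d; split=> // x h.
  apply: le_trans (e x _) _; first by rewrite (lt_le_trans h) // lef_pV2 ?posrE.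
  by rewrite ler_pM2r ?exprn_gt0 ?invr_gt0.
by apply: le_trans (u x h) _; rewrite lerXn2r ?nnegrE ?(ltW B0) ?(ltW B'0).
Qed.

(** The terms of a convergent power series are bounded at distance r / 2 from
    the centre, so at distance r / 4 the remainder decreases like 2^-d. *)
Lemma analytic_at_series f (z : R[i]) : analytic_at f z ->
  exists (c : nat -> R[i]) (r C : R), [/\ 0 < r, 0 <= C,
    forall k, normc (c k) * (r / 2) ^+ k <= C &
    forall w d, normc (w - z) <= r / 4 ->
      normc (f w - \sum_(k < d.+1) c k * (w - z) ^+ k) <= C * 2^-1 ^+ d].
Proof.
case=> c /nbhs_ballP [e /= e0 he].
pose r := complex.Re e.
have eE : e = r%:C by rewrite /r RRe_real // gtr0_real.
have r0 : 0 < r by rewrite -ltcR -eE.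
have cvg_at w : normc (w - z) < r ->
    (series (fun k => c k * (w - z) ^+ k : R[i]^o)) @ \oo --> (f w : R[i]^o).
  move=> wr; apply: he; rewrite -ball_normE /= cabsE eE ltcR.
  by rewrite cabs_distC.
have seriesE w n : series (fun k => c k * (w - z) ^+ k : R[i]^o) n =
    \sum_(k < n) c k * (w - z) ^+ k by rewrite /series /= big_mkord.
have cvg_dist w (eps : R) : normc (w - z) < r -> 0 < eps ->
    \forall n \near \oo, normc (f w - \sum_(k < n) c k * (w - z) ^+ k) < eps.
  move=> wr ep0; have /cvgrPdist_lt/(_ eps%:C) := cvg_at w wr.
  rewrite ltcR => /(_ ep0); apply: filterS => n.
  by rewrite seriesE cabsE ltcR.
have [C C0 hC] : exists2 C : R, 0 <= C & forall k, normc (c k) * (r / 2) ^+ k <= C.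
  pose w := z + (r / 2)%:C.
  have wz : w - z = (r / 2)%:C by rewrite /w addrC addKr.
  have nwz : normc (w - z) = r / 2 by rewrite wz cabs_real ger0_norm // divr_ge0 // ltW.
  have wr : normc (w - z) < r by rewrite nwz; lra.
  have [N _ hN] := cvg_dist w 1 wr ltr01.
  exists (2 + \sum_(k < N) normc (c k) * (r / 2) ^+ k).
    rewrite addr_ge0 // sumr_ge0 // => k _.
    by rewrite mulr_ge0 ?cabs_ge0 ?exprn_ge0 ?divr_ge0 ?(ltW r0).
  have pos k : 0 <= normc (c k) * (r / 2) ^+ k.
    by rewrite mulr_ge0 ?cabs_ge0 ?exprn_ge0 ?divr_ge0 ?(ltW r0).
  have S0 : 0 <= \sum_(k < N) normc (c k) * (r / 2) ^+ k by apply: sumr_ge0.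
  move=> k; have [kN|Nk] := ltnP k N.
    rewrite (bigD1 (Ordinal kN)) //= addrCA lerDl addr_ge0 //.
    by apply: sumr_ge0.
  have := hN k Nk; have := hN k.+1 (leqW Nk) => /=.
  set s := \sum_(i < k.+1) _; set s' := \sum_(i < k) _ => h1 h2.
  have -> : normc (c k) * (r / 2) ^+ k = normc ((f w - s') - (f w - s)).
    rewrite opprB addrC addrA subrK /s big_ord_recr /= -/s' addrC addKr.
    by rewrite cabsM cabsX nwz.
  apply: le_trans (cabsB _ _) _; lra.
exists c, r, C; split=> // w d w4.
have wr : normc (w - z) < r by apply: le_lt_trans w4 _; lra.
apply/ler_addgt0Pr => eps ep0.
have [N _ hN] := cvg_dist w eps wr ep0.
pose D := (d.+1 + N)%N; have := hN D (leq_addl _ _) => /= hD.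
have SD : \sum_(k < D) c k * (w - z) ^+ k = \sum_(k < d.+1) c k * (w - z) ^+ k
   + \sum_(k < N) c (d.+1 + k)%N * (w - z) ^+ (d.+1 + k).
  by rewrite big_split_ord.
rewrite -(subrK (\sum_(k < D) c k * (w - z) ^+ k) (f w)) -addrA.
apply: le_trans (cabsD _ _) _; rewrite [leRHS]addrC; apply: lerD; first exact: ltW.
rewrite SD addrC addKr; apply: le_trans (cabs_sum _ _ _) _.
have q2 : 0 <= (2^-1 : R) < 1 by apply/andP; split; lra.
apply: le_trans (_ : \sum_(k < N) C * 2^-1 ^+ d.+1 * 2^-1 ^+ k <= _).
  apply: ler_sum => k _; rewrite cabsM cabsX -mulrA -exprD.
  apply: le_trans (_ : normc (c (d.+1 + k)%N) * (r / 4) ^+ (d.+1 + k) <= _).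
    by rewrite ler_wpM2l ?cabs_ge0 // lerXn2r ?nnegrE ?cabs_ge0 // divr_ge0 // ltW.
  have -> : r / 4 = r / 2 * 2^-1 by field.
  rewrite exprMn mulrA ler_wpM2r ?hC // exprn_ge0 //; lra.
rewrite -mulr_sumr exprS.
apply: le_trans (ler_wpM2l _ (sum_geometric_le _ q2)) _.
  by rewrite mulr_ge0 // mulr_ge0 ?exprn_ge0 //; lra.
have -> : 1 - 2^-1 = 2^-1 :> R by field.
by rewrite invrK mulrC; lra.
Qed.

Lemma analytic_at_locally_approx f z : 0 <= z <= 1 -> analytic_at f z%:C ->
  exists2 B : R, 0 < B & \forall z' \near z, locally_approx (fun x => f x%:C) B z'.
Proof.
move=> z01 /analytic_at_series [c [r [C [r0 C0 cC fC]]]].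
pose B := C + 4 + 4 / r + 8 / r.
have r40 : 0 < 4 / r by rewrite divr_gt0.
have r80 : 0 < 8 / r by rewrite divr_gt0.
have B0 : 0 < B by rewrite /B; lra.
exists B => //; apply/nbhs_ballP; exists (r / 8); first by rewrite /= divr_gt0.
move=> z' /=; rewrite -ball_normE /= => zz'.
exists (fun d => \sum_(k < d.+1) c k *: ('X - z%:C%:P) ^+ k) => d.
have hE x : (\sum_(k < d.+1) c k *: ('X - z%:C%:P) ^+ k).[x%:C] =
    \sum_(k < d.+1) c k * (x%:C - z%:C) ^+ k.
  by rewrite horner_sum; apply: eq_bigr => k _; rewrite hornerZ horner_exp hornerXsubC.
split.
- apply: leq_trans (size_sum _ _ _) _; apply/bigmax_leqP => k _.
  rewrite (leq_trans (size_scale_leq _ _)) //.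
  by rewrite size_exp_XsubC ltn_ord.
- move=> x xz; rewrite hE; apply: le_trans (fC _ _ _) _.
    rewrite -rmorphB cabs_real.
    have Br : B^-1 <= r / 8.
      by rewrite -[r / 8]invrK lef_pV2 ?posrE ?invr_gt0 ?divr_gt0 // invf_div /B; lra.
    apply: le_trans (ler_distD z' _ _) _.
    rewrite distrC in zz'; lra.
  rewrite ler_pM2r ?exprn_gt0 ?invr_gt0 // /B; lra.
move=> x x01; rewrite hE; apply: le_trans (cabs_sum _ _ _) _.
apply: le_trans (_ : \sum_(k < d.+1) C * (2 + 2 / r) ^+ d <= _).
  apply: ler_sum => k _; rewrite cabsM cabsX -rmorphB cabs_real.
  have xz1 : `|x - z| ^+ k <= 1.
    rewrite exprn_ile1 // ler_norml; move: x01 z01 => /andP[? ?] /andP[? ?].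
    by apply/andP; split; lra.
  have r2 : 0 < r / 2 by rewrite divr_gt0.
  have M1 : 1 <= 2 + 2 / r by have : 0 < 2 / r by [rewrite divr_gt0]; lra.
  apply: le_trans (_ : normc (c k) <= _).
    by rewrite ler_piMr ?cabs_ge0.
  apply: le_trans (_ : C * (2 / r) ^+ k <= _).
    have := cC k; rewrite -ler_pdivlMr ?exprn_gt0 // -exprVn invf_div.
    by [].
  rewrite ler_wpM2l //; apply: le_trans (_ : (2 + 2 / r) ^+ k <= _).
    rewrite lerXn2r ?nnegrE //; first by rewrite divr_ge0 // ltW.
      by rewrite (le_trans _ M1).
    by rewrite lerDr.
  by rewrite ler_weXn2l // -ltnS.
rewrite sumr_const card_ord -[leLHS]mulr_natl.
have d2 : d.+1%:R <= 2 ^+ d :> R.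
  by rewrite -natrX ler_nat; elim: (d) => // k IH; rewrite expnS; lia.
have MB : 2 * (2 + 2 / r) <= B.
  have -> : 2 * (2 + 2 / r) = 4 + 4 / r by field; rewrite gt_eqF.
  by rewrite /B; lra.
have B1 : 1 <= B by rewrite /B; lra.
have M0 : 0 < 2 + 2 / r by rewrite addr_gt0 // divr_gt0.
apply: le_trans (_ : 2 ^+ d * (C * (2 + 2 / r) ^+ d) <= _).
  by rewrite ler_wpM2r // mulr_ge0 // exprn_ge0 // ltW.
rewrite mulrCA -exprMn exprS ler_pM ?exprn_ge0 //.
- by rewrite mulr_ge0 // ltW.
- by rewrite /B; lra.
by rewrite lerXn2r ?nnegrE ?mulr_ge0 ?(ltW M0) ?(ltW B0).
Qed.

End LocalApproximation.
(** * Polynomial approximation at a geometric rate *)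

Section GeometricApproximation.
Variable R : realType.
Implicit Types (g : R -> R[i]) (f : R[i] -> R[i]) (x z : R).

(** Compactness of [0, 1], by monotonicity of locally_approx in B. *)
Lemma analytic_near_uniform_local f : analytic_near f (unit_interval R) ->
  exists2 B : R, 2 <= B &
    forall z, 0 <= z <= 1 -> locally_approx (fun x => f x%:C) B z.
Proof.
case=> U [_ IU fU].
have /compact_near_coveringP cov := @segment_compact R 0 1.
have [] := cov nat \oo (fun n z => locally_approx (fun x => f x%:C) n.+2%:R z) _ _.
  move=> z /=; rewrite in_itv /= => z01.
  have fz : analytic_at f z%:C by apply/fU/IU; exists z => //=; rewrite in_itv.
  have [B B0 hB] := analytic_at_locally_approx z01 fz.
  near=> z' n => /=.
  apply: (@locally_approx_mono _ _ B) => //; last by near: z'.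
  apply: le_trans (_ : n%:R <= _); last by rewrite ler_nat; lia.
  by near: n; exact: near_ge_nat.
move=> N _ /(_ N (leqnn _)) hN; exists N.+2%:R; first by rewrite ler_nat.
by move=> z z01; apply: hN; rewrite /= in_itv.
Unshelve. all: by end_near. Qed.

(** The probability that a binomial variable with parameters N and x takes the
    value k. *)
Definition bernstein N k x : R := 'C(N, k)%:R * (x ^+ k * (1 - x) ^+ (N - k)).

Lemma bernstein_ge0 N k x : 0 <= x <= 1 -> 0 <= bernstein N k x.
Proof. by move=> /andP[? ?]; rewrite !mulr_ge0 // exprn_ge0 // subr_ge0. Qed.

Lemma bernstein_moment N x a b :
  \sum_(k < N.+1) bernstein N k x * (a ^+ k * b ^+ (N - k)) =
  (x * a + (1 - x) * b) ^+ N.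
Proof.
rewrite addrC exprDn; apply: eq_bigr => k _.
by rewrite /bernstein !exprMn -[RHS]mulr_natl; ring.
Qed.

Lemma bernstein_sum1 N x : \sum_(k < N.+1) bernstein N k x = 1.
Proof.
have := bernstein_moment N x 1 1; rewrite !mulr1 addrC subrK expr1n => <-.
by apply: eq_bigr => k _; rewrite !expr1n !mulr1.
Qed.

(** The exponential moment of the centred binomial distribution, from which
    Chernoff's inequality follows. *)
Lemma bernstein_tail N x (l : R) : 0 <= x <= 1 -> `|l| <= 2^-1 ->
  \sum_(k < N.+1) bernstein N k x * expR (l * (k%:R - N%:R * x)) <=
  expR (2 * l ^+ 2 * N%:R).
Proof.
move=> /andP[x0 x1]; rewrite ler_norml => /andP[l1 l2].
have quad (z : R) : z <= 2^-1 -> expR z <= 1 + z + 2 * z ^+ 2.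
  move=> z2; have e1 := expR_ge1Dx (- z).
  have p0 : 0 < 1 - z by lra.
  apply: le_trans (_ : (1 - z)^-1 <= _).
    by rewrite -[expR z]invrK lef_pV2 ?posrE ?invr_gt0 ?expR_gt0 // -expRN.
  rewrite -(ler_pM2l p0) divff ?gt_eqF //.
  have : 0 <= z ^+ 2 * (1 - 2 * z) by rewrite mulr_ge0 ?sqr_ge0 //; lra.
  nra.
rewrite (eq_bigr (fun k : 'I_N.+1 => bernstein N k x *
    (expR (l * (1 - x)) ^+ k * expR (- (l * x)) ^+ (N - k)))); last first.
  move=> k _; congr (_ * _); rewrite -!expRM_natl -expRD; congr expR.
  have kN : (k <= N)%N by rewrite -ltnS.
  by rewrite natrB //; ring.
rewrite bernstein_moment [2 * _ * _]mulrC expRM_natl.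
have E1 : expR (l * (1 - x)) <= 1 + l * (1 - x) + 2 * (l * (1 - x)) ^+ 2 by apply: quad; nra.
have E2 : expR (- (l * x)) <= 1 + - (l * x) + 2 * (- (l * x)) ^+ 2 by apply: quad; nra.
have x1' : 0 <= 1 - x by lra.
rewrite lerXn2r ?nnegrE ?expR_ge0 ?addr_ge0 ?mulr_ge0 ?expR_ge0 //.
apply: le_trans (expR_ge1Dx _).
have := ler_wpM2l x0 E1; have := ler_wpM2l x1' E2.
have H : 0 <= l ^+ 2 * (1 - x * (1 - x)).
  by rewrite mulr_ge0 ?sqr_ge0 //; nra.
have -> : (1 - x) * (1 + - (l * x) + 2 * (- (l * x)) ^+ 2) =
   1 - x - l * x * (1 - x) + 2 * l ^+ 2 * (x ^+ 2 * (1 - x)) by ring.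
have -> : x * (1 + l * (1 - x) + 2 * (l * (1 - x)) ^+ 2) =
   x + l * x * (1 - x) + 2 * l ^+ 2 * (x * (1 - x) ^+ 2) by ring.
have -> : x ^+ 2 * (1 - x) = x * (1 - x) - x * (1 - x) ^+ 2 by ring.
lra.
Qed.

Definition bernstein_poly N k : {poly R[i]} :=
  'C(N, k)%:R *: ('X ^+ k * (1 - 'X) ^+ (N - k)).

Lemma horner_bernstein N k x :
  (bernstein_poly N k).[x%:C] = (bernstein N k x)%:C.
Proof.
rewrite /bernstein hornerZ hornerM !horner_exp hornerD hornerN hornerX hornerC.
by rewrite !rmorphM !rmorphXn rmorphB rmorph1 rmorph_nat.
Qed.

Lemma size_bernstein N k : (k <= N)%N -> (size (bernstein_poly N k) <= N.+1)%N.
Proof.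
move=> kN; rewrite (leq_trans (size_scale_leq _ _)) //.
rewrite (leq_trans (size_polyMleq _ _)) // size_polyXn.
have s2 : (size (1 - 'X : {poly R[i]})%R <= 2)%N.
  by rewrite -opprB size_polyN size_XsubC.
have se : (size ((1 - 'X : {poly R[i]}) ^+ (N - k))%R <= (N - k).+1)%N.
  apply: leq_trans (size_poly_exp_leq _ _) _; rewrite ltnS.
  by rewrite -[leqRHS]mul1n leq_mul2r -subn1 leq_subLR s2 orbT.
by rewrite addSn /= (leq_trans (leq_add (leqnn k) se)) // addnS subnKC.
Qed.

(** Glue the local approximations with Bernstein weights: the approximant is
    sum_k bernstein N k times the d-th local approximation at k / N. The terms
    with k / N close to x have error 2^-d; the others grow at most like B^d, but
    their total weight is at most exp (- N / (8 B^2)), which wins as soon as N is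
    a large enough multiple of d. *)
Lemma geometric_approximation g B : 2 <= B ->
  (forall z, 0 <= z <= 1 -> locally_approx g B z) ->
  exists (A : nat) (C : R), (0 < A)%N /\ 0 <= C /\ forall d, exists q : {poly R[i]},
    (size q <= A * d.+1)%N /\
    forall x, 0 <= x <= 1 -> normc (g x - q.[x%:C]) <= C * 2^-1 ^+ d.
Proof.
move=> B2 gB; have B0 : 0 < B by lra.
have /choice[P hP] z : exists p : nat -> {poly R[i]}, 0 <= z <= 1 ->
    forall d, [/\ (size (p d) <= d.+1)%N,
    forall x, `|x - z| < B^-1 -> normc (g x - (p d).[x%:C]) <= B * 2^-1 ^+ d &
    forall x, 0 <= x <= 1 -> normc (p d).[x%:C] <= B ^+ d.+1].
  have [z01|_] := boolP (0 <= z <= 1); last by exists (fun=> 0).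
  by have [p hp] := gB z z01; exists p.
have gbound x : 0 <= x <= 1 -> normc (g x) <= 2 * B.
  move=> x01; have [_ h1 h2] := hP x x01 0%N.
  have := h2 x x01; have := h1 x; rewrite subrr normr0 invr_gt0 B0 => /(_ isT).
  rewrite expr0 expr1 mulr1 => h3 h4; rewrite -(subrK (P x 0%N).[x%:C] (g x)).
  by apply: le_trans (cabsD _ _) _; lra.
have [A0 _ hA] := near_ge_nat (8 * B ^+ 2 * (ln B + 1)).
pose A := A0.+1; have AB : 8 * B ^+ 2 * (ln B + 1) <= A%:R by apply: hA => /=.
exists A.+1, (B + 6); split=> //; split; first by lra.
(* With this N the weight of the far terms beats B^(d+1) by e^(-d-1). *)
move=> d; pose N := (A * d.+1)%N.
have N0 : (0 < N)%N by rewrite muln_gt0.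
have NR : 0 < N%:R :> R by rewrite ltr0n.
pose z k : R := k%:R / N%:R.
have z01 (k : 'I_N.+1) : 0 <= z k <= 1.
  by rewrite divr_ge0 //= ler_pdivrMr // mul1r ler_nat -ltnS.
exists (\sum_(k < N.+1) bernstein_poly N k * P (z k) d); split.
  apply: leq_trans (size_sum _ _ _) _; apply/bigmax_leqP => k _.
  apply: leq_trans (size_polyMleq _ _) _.
  have [sP _ _] := hP _ (z01 k) d.
  have := @size_bernstein N k (ltn_ord k : (k <= N)%N).
  by rewrite mulSn -/N; lia.
move=> x x01; have /andP[x0 x1] := x01.
(* This exponent minimizes 2 l^2 N - l N / B. *)
pose l : R := (4 * B)^-1.
have l0 : 0 < l by rewrite invr_gt0 mulr_gt0.
have l2 : `|l| <= 2^-1.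
  by rewrite gtr0_norm // lef_pV2 ?posrE ?mulr_gt0 //; lra.
pose tail (k : nat) : R := expR (l * (k%:R - N%:R * x)) +
  expR (- l * (k%:R - N%:R * x)).
pose err := 3 * B ^+ d.+1 * expR (- (l * (N%:R / B))).
have err0 : 0 <= err by rewrite !mulr_ge0 ?expR_ge0 ?exprn_ge0 // ltW.
have pointwise (k : 'I_N.+1) : normc (g x - (P (z k) d).[x%:C]) <=
    B * 2^-1 ^+ d + err * tail k.
  have [_ h1 h2] := hP _ (z01 k) d.
  have t0 : 0 <= tail k by rewrite addr_ge0 ?expR_ge0.
  have b0 : 0 <= B * 2^-1 ^+ d by rewrite mulr_ge0 ?exprn_ge0 // ltW.
  have [near_z|far_z] := ltP `|x - z k| B^-1.
    by apply: le_trans (h1 x near_z) _; rewrite lerDl mulr_ge0.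
  apply: le_trans (cabsB _ _) _.
  apply: le_trans (_ : 3 * B ^+ d.+1 <= _).
    have := gbound x x01; have := h2 x x01.
    have : B <= B ^+ d.+1 by rewrite -[leLHS]expr1 ler_weXn2l //; lra.
    lra.
  rewrite -[leLHS]add0r; apply: lerD => //.
  rewrite /err -mulrA ler_peMr //; first by rewrite mulr_ge0 ?exprn_ge0 // ltW.
  rewrite /tail mulrDr -!expRD.
  have far : N%:R / B <= `|k%:R - N%:R * x|.
    have -> : k%:R - N%:R * x = N%:R * (z k - x) by rewrite /z; field; rewrite gt_eqF.
    by rewrite normrM gtr0_norm // distrC ler_pM2l.
  have [s|s] := leP 0 (k%:R - N%:R * x).
    rewrite ger0_norm // in far.
    apply: le_trans (_ : expR (- (l * (N%:R / B)) + l * (k%:R - N%:R * x)) <= _).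
      by rewrite -[leLHS]expR0 ler_expR [leRHS]addrC subr_ge0 ler_pM2l.
    by rewrite lerDl expR_ge0.
  rewrite ltr0_norm // in far.
  apply: le_trans (_ : expR (- (l * (N%:R / B)) + - l * (k%:R - N%:R * x)) <= _).
    by rewrite -[leLHS]expR0 ler_expR [leRHS]addrC mulNr -mulrN subr_ge0 ler_pM2l.
  by rewrite lerDr expR_ge0.
have -> : g x - (\sum_(k < N.+1) bernstein_poly N k * P (z k) d).[x%:C] =
    \sum_(k < N.+1) (bernstein N k x)%:C * (g x - (P (z k) d).[x%:C]).
  rewrite (eq_bigr (fun k : 'I_N.+1 => (bernstein N k x)%:C * g x -
    (bernstein N k x)%:C * (P (z k) d).[x%:C])) => [|k _]; last by rewrite mulrBr.
  rewrite sumrB -mulr_suml -rmorph_sum bernstein_sum1 mul1r; congr (_ - _).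
  by rewrite horner_sum; apply: eq_bigr => k _; rewrite hornerM horner_bernstein.
apply: le_trans (cabs_sum _ _ _) _.
apply: le_trans (_ : \sum_(k < N.+1) bernstein N k x *
  (B * 2^-1 ^+ d + err * tail k) <= _).
  apply: ler_sum => k _; rewrite cabsM cabs_real ger0_norm ?bernstein_ge0 //.
  by rewrite ler_wpM2l ?bernstein_ge0.
rewrite (eq_bigr (fun k : 'I_N.+1 => bernstein N k x * (B * 2^-1 ^+ d) +
  (err * (bernstein N k x * expR (l * (k%:R - N%:R * x))) +
   err * (bernstein N k x * expR (- l * (k%:R - N%:R * x)))))); last first.
  by move=> k _; rewrite /tail; ring.
rewrite !big_split /= -mulr_suml bernstein_sum1 mul1r -!mulr_sumr.
rewrite mulrDl; apply: lerD => //.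
have T1 := bernstein_tail N x01 l2.
have T2 : \sum_(k < N.+1) bernstein N k x * expR (- l * (k%:R - N%:R * x)) <=
  expR (2 * l ^+ 2 * N%:R).
  by rewrite -(sqrrN l) bernstein_tail // normrN.
apply: le_trans (lerD (ler_wpM2l err0 T1) (ler_wpM2l err0 T2)) _.
have -> : err * expR (2 * l ^+ 2 * N%:R) =
    3 * (B ^+ d.+1 * expR (- (N%:R / (8 * B ^+ 2)))).
  rewrite /err -!mulrA -expRD; congr (_ * (_ * expR _)).
  by rewrite /l; field; rewrite gt_eqF.
suff main : B ^+ d.+1 * expR (- (N%:R / (8 * B ^+ 2))) <= 2^-1 ^+ d by lra.
have B8 : 0 < 8 * B ^+ 2 by rewrite mulr_gt0 ?exprn_gt0.
have exp1 : expR (- 1) <= 2^-1 :> R.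
  by rewrite expRN lef_pV2 ?posrE ?expR_gt0 //; have := expR_ge1Dx (1 : R); lra.
apply: le_trans (_ : expR (- 1) ^+ d.+1 <= _); last first.
  apply: le_trans (_ : (2^-1 : R) ^+ d.+1 <= _).
    by rewrite lerXn2r ?nnegrE ?expR_ge0.
  by rewrite ler_wiXn2l //; lra.
rewrite -[B in B ^+ _]lnK ?posrE // -!expRM_natl -expRD ler_expR.
have : d.+1%:R * (ln B + 1) <= N%:R / (8 * B ^+ 2).
  rewrite ler_pdivlMr // /N natrM.
  have -> : d.+1%:R * (ln B + 1) * (8 * B ^+ 2) = 8 * B ^+ 2 * (ln B + 1) * d.+1%:R by ring.
  by rewrite ler_pM2r ?ltr0n.
lra.
Qed.

End GeometricApproximation.

(** * Convergence of the interpolants *)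

Section Convergence.
Variables (R : realType) (t : nat -> R).
Hypothesis t_leja : fast_leja_sequence t.
Hypothesis t_star : sequence_property_star t.

Lemma geometric_small (q c eps : R) : 0 <= q < 1 -> 0 < eps ->
  exists T, forall k, (T <= k)%N -> c * q ^+ k <= eps.
Proof.
move=> /andP[q0 q1] ep0; have qabs : `|q| < 1 by rewrite ger0_norm.
have /cvgr0Pnorm_le/(_ eps ep0) := cvg_geometric c qabs.
by case=> T _ hT; exists T => k Tk; apply: le_trans (ler_norm _) (hT k Tk).
Qed.

Let a j : R[i] := (t j)%:C.

Let a_inj : injective a.
Proof. by move=> i j [] /(fast_leja_injective t_leja). Qed.

Lemma interpolant_poly n (p : {poly R[i]}) : (size p <= n.+1)%N ->
  interpolant a (fun z => p.[z]) n = p.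
Proof. by move=> sp; exact: interpolantE. Qed.

Lemma interpolant_lagrange n : exists L : nat -> {poly R[i]}, forall f,
  interpolant a f n = \sum_(j < n.+1) f (a j) *: L j.
Proof.
exists (fun j => interpolant a (fun z => (z == a j)%:R) n) => f.
have LP j : interpolates a (fun z => (z == a j)%:R) n
    (interpolant a (fun z => (z == a j)%:R) n).
  have [p [pI _]] := interpolates_unique (fun z => (z == a j)%:R) n a_inj.
  by apply: xgetPex; exists p.
apply: interpolantE => //; split=> [|i ilt].
  apply: leq_trans (size_sum _ _ _) _; apply/bigmax_leqP => j _.
  by rewrite (leq_trans (size_scale_leq _ _)) //; have [] := LP j.
rewrite horner_sum (bigD1 (Ordinal (ilt : (i < n.+1)%N))) //= big1 => [|j ji].
  by have [_ Li] := LP i; rewrite hornerZ Li // eqxx mulr1 addr0.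
have [_ Lj] := LP j; rewrite hornerZ Lj // (inj_eq a_inj).
by rewrite eq_sym (_ : (nat_of_ord j == i) = false) ?mulr0 //; apply/negbTE.
Qed.

(** The error of the interpolant of f is the limit of the errors for its
    polynomial approximations q_d. These vanish as long as deg q_d <= n, and each
    further step q_(d+1) - q_d, of size 2^-d and degree O(d), contributes at most
    (3/4)^d when the exponential rate e is small enough. *)
Lemma interpolation_error_cvg (f : R[i] -> R[i]) (eps : R) :
  analytic_near f (unit_interval R) -> 0 < eps -> \forall n \near \oo,
  forall x, 0 <= x <= 1 ->
    normc (f x%:C - (interpolant a f n).[x%:C]) <= eps.
Proof.
move=> /analytic_near_uniform_local [B B2 hB] ep0.
have [A [C [A0 [C0 /choice[q hq]]]]] := geometric_approximation B2 hB.
have AR : 0 < A%:R :> R by rewrite ltr0n.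
have l32 : 0 < ln (3 / 2) :> R by rewrite ln_gt0 //; lra.
(* So that exp (2 A e) = 3/2, and 3/2 times the rate 1/2 is still below 1. *)
pose e : R := ln (3 / 2) / (2 * A%:R).
have e0 : 0 < e by rewrite divr_gt0 ?mulr_gt0.
have [C1 [C10 [N1 _ hN1]]] := interpolation_error_subexponential t_leja t_star e0.
pose K := C1 * (2 * C) * (9 / 4).
have K0 : 0 <= K by rewrite !mulr_ge0 //; lra.
have q34 : 0 <= (3 / 4 : R) < 1 by apply/andP; split; lra.
have q12 : 0 <= (2^-1 : R) < 1 by apply/andP; split; lra.
have ep2 : 0 < eps / 2 by rewrite divr_gt0.
have [T hT] := geometric_small (K * 4) q34 ep2.
exists (maxn N1 (A * T.+1)) => // n /=; rewrite geq_max => /andP[Nn An] x x01.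
(* d0 is the last index with size (q d0) <= n + 1. *)
have [d0 [Td0 An1 An2]] : exists d0, [/\ (T <= d0)%N,
    (A * d0.+1 <= n.+1)%N & (n <= A * d0.+2)%N].
  have Aq : (T.+1 <= n.+1 %/ A)%N by rewrite leq_divRL // mulnC (leq_trans An).
  exists (n.+1 %/ A).-1; rewrite prednK ?(leq_trans _ Aq) //; split.
  - by rewrite -ltnS prednK // (leq_trans _ Aq).
  - by rewrite mulnC leq_trunc_div.
  by rewrite mulnC ltnW // ltnW // ltn_ceil.
have [L LE] := interpolant_lagrange n.
pose E (p : {poly R[i]}) := p.[x%:C] - (interpolant a (fun z => p.[z]) n).[x%:C].
have ED p p' : E p' = E p + E (p' - p).
  rewrite /E !LE !horner_sum hornerD hornerN.
  rewrite [X in _ = _ + (_ - X)](_ : _ = \sum_(j < n.+1) (p'.[a j] *: L j).[x%:C]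
    - \sum_(j < n.+1) (p.[a j] *: L j).[x%:C]); first by ring.
  rewrite -sumrB; apply: eq_bigr => j _.
  by rewrite hornerD hornerN scalerBl hornerD hornerN.
have step d : (d0 <= d)%N -> normc (E (q d.+1 - q d)) <= K * (3 / 4) ^+ d.
  move=> d0d; have [s0 h0] := hq d; have [s1 h1] := hq d.+1.
  have sz : (size (q d.+1 - q d)%R <= (A * d.+2).+1)%N.
    apply: leq_trans (size_polyD _ _) _; rewrite size_polyN geq_max.
    rewrite leqW //= leqW // (leq_trans s0) // leq_mul2l leqnSn orbT //.
  have sup z : 0 <= z <= 1 -> normc (q d.+1 - q d).[z%:C] <= 2 * C * 2^-1 ^+ d.
    move=> z01; rewrite hornerD hornerN.
    have -> : (q d.+1).[z%:C] - (q d).[z%:C] =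
      (f z%:C - (q d).[z%:C]) - (f z%:C - (q d.+1).[z%:C]) by ring.
    apply: le_trans (cabsB _ _) _; have := h0 z z01; have := h1 z z01.
    have : C * 2^-1 ^+ d.+1 <= C * 2^-1 ^+ d.
      by rewrite ler_wpM2l // ler_wiXn2l //; lra.
    lra.
  apply: le_trans (hN1 n Nn _ _ _ x sz sup x01) _.
  have : expR (e * (n + A * d.+2)%:R) <= (3 / 2) ^+ d.+2.
    apply: le_trans (_ : expR (e * (2 * A%:R) * d.+2%:R) <= _).
      rewrite ler_expR -mulrA ler_pM2l // natrD -mulrA mulr2n mulrDl !mul1r -natrM.
      rewrite lerD2r ler_nat (leq_trans An2) // leq_mul2l ltnS ltnS d0d orbT //.
    by rewrite /e divfK ?expRM_natr ?lnK ?posrE // gt_eqF // mulr_gt0.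
  move=> h; apply: le_trans (ler_wpM2l _ h) _.
    by rewrite !mulr_ge0 // exprn_ge0 //; lra.
  have -> : (3 / 4 : R) = 2^-1 * (3 / 2) by field.
  rewrite /K !exprS (exprMn d 2^-1 (3 / 2)); move: (2^-1 ^+ d) ((3 / 2) ^+ d) => u v.
  by rewrite le_eqVlt; apply/orP; left; apply/eqP; field.
have Esum j : normc (E (q (d0 + j)%N)) <= \sum_(i < j) K * (3 / 4) ^+ (d0 + i).
  elim: j => [|j IH].
    rewrite addn0 big_ord0 /E interpolant_poly ?subrr ?normc0 //.
    by have [s0 _] := hq d0; exact: leq_trans An1.
  rewrite addnS (ED (q (d0 + j)%N)) big_ord_recr /=.
  by apply: le_trans (cabsD _ _) _; apply: lerD; rewrite ?step ?leq_addr.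
have Ebound j : normc (E (q (d0 + j)%N)) <= eps / 2.
  apply: le_trans (Esum j) _; apply: le_trans (hT d0 Td0).
  rewrite (eq_bigr (fun i : 'I_j => K * (3 / 4) ^+ d0 * (3 / 4) ^+ i)); last first.
    by move=> i _; rewrite exprD mulrA.
  rewrite -mulr_sumr [leLHS]mulrAC.
  have c0 : 0 <= (3 / 4 : R) ^+ d0 by rewrite exprn_ge0 //; case/andP: q34.
  apply: ler_wpM2r => //.
  rewrite ler_wpM2l //; apply: le_trans (sum_geometric_le j q34) _.
  by rewrite (_ : 1 - 3 / 4 = 4^-1) ?invrK //; field.
pose Lam := \sum_(j < n.+1) normc (L j).[x%:C].
have Lam0 : 0 <= Lam by apply: sumr_ge0 => j _; exact: cabs_ge0.
have [D hD] := geometric_small (C * (1 + Lam)) q12 ep2.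
pose d := (d0 + D)%N.
have -> : f x%:C - (interpolant a f n).[x%:C] = (f x%:C - (q d).[x%:C]) + E (q d) +
    ((interpolant a (fun z => (q d).[z]) n).[x%:C] - (interpolant a f n).[x%:C]).
  by rewrite /E; ring.
have [_ hqd] := hq d.
(* For fixed n the interpolation operator is bounded, by Lam at x. *)
have last_le : normc ((interpolant a (fun z => (q d).[z]) n).[x%:C] -
    (interpolant a f n).[x%:C]) <= C * 2^-1 ^+ d * Lam.
  rewrite !LE !horner_sum -sumrB mulr_sumr; apply: le_trans (cabs_sum _ _ _) _.
  apply: ler_sum => j _; rewrite !hornerZ -mulrBl cabsM ler_wpM2r ?cabs_ge0 //.
  by rewrite cabs_distC hqd // fast_leja_bounds.
have := hD d (leq_addl _ _); have := Ebound D; have := hqd x x01 => h1 h2 h3.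
apply: le_trans (cabsD _ _) _.
apply: le_trans (lerD (cabsD _ _) (lexx _)) _.
rewrite -/d in h2; move: h3; rewrite mulrDr mulr1 mulrDl [C * Lam * _]mulrAC; lra.
Qed.

End Convergence.

Unset Implicit Arguments.

Theorem theorem4p3 (R : realType) (t : nat -> R)
    (t_fast_leja : fast_leja_sequence t)
    (t_star : sequence_property_star t) :
  (fun n => VDM_root (fun j : 'I_n => (t j)%:C)) @ \oo
    --> transfinite_diameter (unit_interval R)
  /\ good_for_interpolation (unit_interval R) (fun j => (t j)%:C).
Proof.
split.
  by rewrite (transfinite_diameterE t_fast_leja t_star); exact: VDM_root_cvg_quarter.
split=> [i j [] /(fast_leja_injective t_fast_leja) //|j|f fan].
  by exists (t j) => //; rewrite /= in_itv /= fast_leja_bounds.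
move=> P /uniform_nbhs [E [entE EP]].
have /= [e e0 eE] : entourage_ (ball : R[i]^o -> R[i] -> set R[i]^o) E.
  by rewrite entourage_ballE.
pose r := complex.Re e.
have er : e = r%:C by rewrite /r RRe_real // gtr0_real.
have r0 : 0 < r by rewrite -ltcR -er.
have r2 : 0 < r / 2 by rewrite divr_gt0.
have near_n := interpolation_error_cvg t_fast_leja t_star fan r2.
apply: (filterS _ near_n) => n hn /=; apply: EP => z [x].
rewrite /= in_itv /= => x01 <-; apply: eE => /=; rewrite -ball_normE /=.
by rewrite cabsE er ltcR; apply: le_lt_trans (hn x x01) _; rewrite ltr_pdivrMr //; lra.
Qed.
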